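(* Let $\Gamma_1$ and $\Gamma_2$ be two negative definite forests, each with exactly one unframed vertex, that differ by a blow-up, and let $G_1,G_2$ be obtained from them by deleting the unframed vertex. Then the filtered lattice chain complexes $(\mathbb{CF}^-(G_1),A)$ and $(\mathbb{CF}^-(G_2),A')$ are filtered chain homotopy equivalent.
   Context: Graphs. $\Gamma$ is a finite forest all of whose vertices carry an integer framing, except exactly one vertex $v_0$, which is unframed (thought of as having framing $-\infty$); $G:=\Gamma-\{v_0\}$ is obtained by deleting $v_0$ and its adjacent edges. For vertices $u\ne u'$ of $\Gamma$ put $u\cdot u'=1$ if they are joined by an edge and $0$ otherwise; for $u\in \mathrm{Vert}(G)$ let $u\cdot u=u^2$ be its framing; extend bilinearly. $\Gamma$ is negative definite if the matrix $(u\cdot u')_{u,u'\in\mathrm{Vert}(G)}$ is negative definite. Blow-ups. There are three types: (i) generic blow-up: add an isolated vertex with framing $-1$; (ii) blow-up of a vertex $v$: add a new vertex of framing $-1$ joined by an edge to $v$ only, and decrease the framing of $v$ by $1$; (iii) blow-up of an edge between $v$ and $w$: replace the edge by a new vertex of framing $-1$ joined to $v$ and to $w$, and decrease the framings of $v$ and $w$ by $1$. If one of the vertices involved is $v_0$, it simply remains unframed. Lattice complex. $X_G$ is the plumbed 4-manifold of $G$; $H_2(X_G;\mathbb{Z})$ is free abelian on $\mathrm{Vert}(G)$, with intersection form the symmetric bilinear form $(x,y)\mapsto x\cdot y$ determined on vertices of $G$ by: $u\cdot u'=1$ if $u\ne u'$ are joined by an edge, $u\cdot u'=0$ if $u\ne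 u'$ are not joined by an edge, and $u\cdot u$ is the framing of $u$. $\mathrm{Char}(G)$ is the set of homomorphisms $K:H_2(X_G;\mathbb{Z})\to\mathbb{Z}$ with $K(x)\equiv x\cdot x \pmod 2$ for all $x$. For a vertex $u$ of $\Gamma$ (including $v_0$), $u^*$ is the homomorphism $u^*(x)=u\cdot x$, so $K+2u^*\in\mathrm{Char}(G)$. For $K\in\mathrm{Char}(G)$ and $E\subset \mathrm{Vert}(G)$ put $f[K,I]=\frac12\big(\sum_{u\in I}K(u)+(\sum_{u\in I}u)^2\big)$ for $I\subset\mathrm{Vert}(G)$ and $g[K,E]=\min_{I\subset E}f[K,I]$. For $u\in E$ let $A_u[K,E]=\min\{f[K,I]: I\subset E-u\}$, $B_u[K,E]=\min\{f[K,I\cup u]: I\subset E-u\}$, $a_u[K,E]=A_u[K,E]-g[K,E]$ and $b_u[K,E]=B_u[K,E]-g[K,E]$. With $\mathbb{F}=\mathbb{Z}/2$, $\mathbb{CF}^-(G)$ is the free $\mathbb{F}[U]$-module generated by all pairs $[K,E]$ with $K\in\mathrm{Char}(G)$, $E\subset\mathrm{Vert}(G)$, with $\mathbb{F}[U]$-linear differential $$\partial[K,E]=\sum_{u\in E}\Big(U^{a_u[K,E]}[K,E-u]+U^{b_u[K,E]}[K+2u^*,E-u]\Big).$$ Knot filtration. Let $\Sigma=v_0+\sum_{u\in \mathrm{Vert}(G)}a_u u$ ($a_u\in\mathbb{Q}$) be the unique class with $u\cdot\Sigma=0$ for all $u\in\mathrm{Vert}(G)$. Fix any auxiliary integer value for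 $v_0^2$ and let $L_{[K,E]}$ be the extension of $K$ to $v_0$ with $L_{[K,E]}(v_0)=-v_0^2+2g[K,E]-2g[K+2v_0^*,E]$. The knot (Alexander) filtration is $A(U^j[K,E])=-j+\frac12\big(L_{[K,E]}(\Sigma)+\Sigma^2\big)$, i.e. $A(U^j[K,E])=-j+g[K,E]-g[K+2v_0^*,E]+\frac12\sum_u a_u\big(K(u)+v_0\cdot u\big)$ (independent of the choice of $v_0^2$). For a sum, $A$ is the maximum over the terms $U^j[K,E]$ occurring, and $A(0)=-\infty$. An $\mathbb{F}[U]$-linear map $\varphi$ is filtered if $A(\varphi(x))\le A(x)$ for all $x$ (with the respective filtrations). Here $A$ and $A'$ are the filtrations defined by $\Gamma_1$ and $\Gamma_2$. Filtered chain homotopy equivalent means: there are filtered $\mathbb{F}[U]$-linear chain maps in both directions whose two compositions are chain homotopic to the identities via filtered $\mathbb{F}[U]$-linear homotopies. *)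

(* Defs.v *)
From HB Require Import structures.
From mathcomp Require Import boolp classical_sets constructive_ereal.
From mathcomp Require Import all_boot all_order all_algebra.
From mathcomp Require Import ring lra zify.
From mathcomp.multinomials Require Import freeg.

Set Implicit Arguments.
Unset Strict Implicit.
Unset Printing Implicit Defensive.

Import Order.TTheory GRing.Theory Num.Theory.

Local Open Scope ring_scope.

(* The vertices of the forest Gamma are [option vert]: [None] is the unframed
   vertex v_0, and [Some u] is the vertex u of G = Gamma - v_0. *)
Record forest := Forest {
  vert : finType;
  edge : rel (option vert);
  framing : vert -> int;
  edge_sym : symmetric edge;
  edge_irr : irreflexive edge;
  edge_acyclic : forall c : seq (option vert), ucycle edge c -> (size c < 3)%N
}.

Section Forest.
Variable Gamma : forest.
Notation V := (vert Gamma).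

(* u . w for u in Vert(Gamma) and w in Vert(G); the product v_0 . v_0 is
   deliberately left out of the domain. *)
Definition dot (u : option V) (w : V) : int :=
  if u == Some w then framing w else (edge u (Some w))%:Z.

(* Elements of H_2(X_G; Z) are integer vectors indexed by Vert(G). *)
Definition H2dot (x y : {ffun V -> int}) : int :=
  \sum_u \sum_w x u * y w * dot (Some u) w.

(* For an integer matrix this agrees with definiteness on real vectors: the form
   is then semidefinite by density, and its kernel is spanned by rational
   vectors. *)
Definition negative_definite : Prop :=
  forall x : {ffun V -> rat}, x != [ffun=> 0] ->
    \sum_u \sum_w x u * x w * (dot (Some u) w)%:~R < 0.

(* A homomorphism K : H_2(X_G; Z) -> Z is given by its values on the basis
   Vert(G); [H2eval K] is its linear extension. *)
Definition H2eval (K x : {ffun V -> int}) : int := \sum_u x u * K u.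

Definition characteristic (K : {ffun V -> int}) : Prop :=
  forall x, (H2eval K x = H2dot x x %[mod 2])%Z.

Definition char := {K : {ffun V -> int} | `[< characteristic K >]}.

Lemma charP (K : char) : characteristic (val K).
Proof. exact/asboolP/(valP K). Qed.

Definition add2dual_fun (K : {ffun V -> int}) (u : option V) : {ffun V -> int} :=
  [ffun w => K w + 2 * dot u w].

Lemma add2dual_subproof (K : char) (u : option V) :
  `[< characteristic (add2dual_fun (val K) u) >].
Proof.
apply/asboolP => x; rewrite -(charP K x) /H2eval.
under eq_bigr => w _ do rewrite ffunE mulrDr mulrCA.
rewrite big_split /= -mulr_sumr addrC mulrC.
by rewrite modzMDl.
Qed.

(* K + 2 u^* *)
Definition add2dual (K : char) (u : option V) : char :=
  Sub (add2dual_fun (val K) u) (add2dual_subproof K u).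

(* The numerator is even because K is characteristic, so the integer division
   is exact (see [fwE]). *)
Definition fw (K : char) (I : {set V}) : int :=
  ((\sum_(u in I) val K u + \sum_(u in I) \sum_(w in I) dot (Some u) w) %/ 2)%Z.

Lemma fwE (K : char) (I : {set V}) :
  2 * fw K I = \sum_(u in I) val K u + \sum_(u in I) \sum_(w in I) dot (Some u) w.
Proof.
rewrite /fw mulrC divzK //.
pose chi : {ffun V -> int} := [ffun u => ((u \in I)%:R : int)].
have -> : \sum_(u in I) val K u = H2eval (val K) chi.
  rewrite /H2eval big_mkcond; apply: eq_bigr => u _; rewrite ffunE.
  by case: (u \in I); rewrite ?mul1r ?mul0r.
have -> : \sum_(u in I) \sum_(w in I) dot (Some u) w = H2dot chi chi.
  rewrite /H2dot big_mkcond; apply: eq_bigr => u _; rewrite big_mkcond ffunE.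
  case: ifP => _; last by rewrite big1 // => w _; rewrite !mul0r.
  apply: eq_bigr => w _; rewrite ffunE mul1r.
  by case: (w \in I); rewrite ?mul1r ?mul0r.
have := charP K chi; lia.
Qed.

(* In each of the next three minima the default element of the iterated
   minimum is itself one of the values minimised over. *)
Definition gw (K : char) (E : {set V}) : int :=
  \big[Num.min/fw K set0]_(I : {set V} | I \subset E) fw K I.

Definition Aw (K : char) (E : {set V}) (u : V) : int :=
  \big[Num.min/fw K set0]_(I : {set V} | I \subset E :\ u) fw K I.

Definition Bw (K : char) (E : {set V}) (u : V) : int :=
  \big[Num.min/fw K [set u]]_(I : {set V} | I \subset E :\ u) fw K (u |: I).

Lemma gw_le_Aw (K : char) (E : {set V}) (u : V) : gw K E <= Aw K E u.
Proof.
apply/bigmin_geP; split=> [|I sIE]; apply: bigmin_le_cond.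
  exact: sub0set.
exact: subset_trans sIE (subsetDl _ _).
Qed.

Lemma gw_le_Bw (K : char) (E : {set V}) (u : V) : u \in E -> gw K E <= Bw K E u.
Proof.
move=> uE; apply/bigmin_geP; split=> [|I sIE]; apply: bigmin_le_cond.
  by rewrite sub1set.
by rewrite subUset sub1set uE (subset_trans sIE (subsetDl _ _)).
Qed.

(* For u in E the differences below are nonnegative ([gw_le_Aw], [gw_le_Bw]),
   so the absolute value only turns an integer into a natural number. *)
Definition aw (K : char) (E : {set V}) (u : V) : nat := `|Aw K E u - gw K E|%N.
Definition bw (K : char) (E : {set V}) (u : V) : nat := `|Bw K E u - gw K E|%N.

(* The rational vector a such that v_0 + \sum_u a_u u is orthogonal to G. *)
Definition Sigma_spec (a : {ffun V -> rat}) : Prop :=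
  forall u : V, (dot None u)%:~R + \sum_w a w * (dot (Some w) u)%:~R = 0 :> rat.

Lemma Sigma_exists_unique : negative_definite ->
  exists! a : {ffun V -> rat}, Sigma_spec a.
Proof.
move=> nd.
pose e (i : 'I_#|V|) : V := enum_val i.
have sumE (F : V -> rat) : \sum_u F u = \sum_i F (e i).
  by rewrite (reindex _ (onW_bij _ (@enum_val_bij V))).
pose M := \matrix_(i, j) ((dot (Some (e i)) (e j))%:~R : rat).
have inj (x : {ffun V -> rat}) :
    (forall u, \sum_w x w * (dot (Some w) u)%:~R = 0) -> x = [ffun=> 0].
  move=> x0; apply/eqP; apply: contraT => /nd.
  rewrite exchange_big /= big1 ?ltxx // => u _.
  under eq_bigr => w _ do rewrite mulrAC.
  by rewrite -mulr_suml x0 mul0r.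
have Mu : M \in unitmx.
  rewrite -row_free_unit; apply: inj_row_free => v vM.
  have xv i : [ffun u => v 0 (enum_rank u)] (e i) = v 0 i.
    by rewrite ffunE enum_valK.
  suff x0 : [ffun u => v 0 (enum_rank u)] = [ffun=> 0] :> {ffun V -> rat}.
    by apply/rowP => i; rewrite -xv x0 ffunE mxE.
  apply: inj => u; rewrite sumE; transitivity ((v *m M) 0 (enum_rank u)).
    by rewrite mxE; apply: eq_bigr => i _; rewrite xv mxE /e enum_rankK.
  by rewrite vM mxE.
pose b : 'rV[rat]_#|V| := \row_i - (dot None (e i))%:~R.
pose a := [ffun u => (b *m invmx M) 0 (enum_rank u)].
have aP : Sigma_spec a.
  move=> u; rewrite sumE.
  have -> : \sum_i a (e i) * (dot (Some (e i)) u)%:~R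
      = (b *m invmx M *m M) 0 (enum_rank u).
    rewrite [RHS]mxE; apply: eq_bigr => i _.
    by rewrite ffunE enum_valK [M _ _]mxE /e enum_rankK.
  by rewrite mulmxKV // mxE /e enum_rankK subrr.
exists a; split=> // c cP.
have/ffunP ac : [ffun u => a u - c u] = [ffun=> 0] :> {ffun V -> rat}.
  apply: inj => u.
  under eq_bigr => w _ do rewrite ffunE mulrBl.
  rewrite sumrB; apply/eqP; rewrite subr_eq0 -(inj_eq (addrI (dot None u)%:~R)).
  by rewrite aP cP.
by apply/ffunP => u; have := ac u; rewrite !ffunE => /subr0_eq.
Qed.

Definition Sigma : {ffun V -> rat} := xget [ffun=> 0] Sigma_spec.

Lemma SigmaP : negative_definite -> Sigma_spec Sigma.
Proof.
by move=> /Sigma_exists_unique [a [aP _]]; apply: (@xgetI _ _ _ a).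
Qed.

(* In the next three definitions m is the auxiliary value of v_0 . v_0. *)
Definition Sigma_sq (m : int) : rat :=
  m%:~R + 2 * \sum_u Sigma u * (dot None u)%:~R
  + \sum_u \sum_w Sigma u * Sigma w * (dot (Some u) w)%:~R.

(* L_{[K,E]}(Sigma), where L_{[K,E]} extends K to v_0. *)
Definition L_Sigma (m : int) (K : char) (E : {set V}) : rat :=
  (- m + 2 * gw K E - 2 * gw (add2dual K None) E)%:~R
  + \sum_u Sigma u * (val K u)%:~R.

(* A(U^j [K,E]) *)
Definition alexander (m : int) (j : nat) (K : char) (E : {set V}) : rat :=
  - j%:R + (L_Sigma m K E + Sigma_sq m) / 2.

Lemma alexanderE (m : int) (j : nat) (K : char) (E : {set V}) :
  negative_definite ->
  alexander m j K E = - j%:R + (gw K E)%:~R - (gw (add2dual K None) E)%:~R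
    + (\sum_u Sigma u * (val K u + dot None u)%:~R) / 2.
Proof.
move=> /SigmaP SP; rewrite /alexander /L_Sigma /Sigma_sq.
have -> : \sum_u \sum_w Sigma u * Sigma w * (dot (Some u) w)%:~R
    = - \sum_u Sigma u * (dot None u)%:~R :> rat.
  rewrite exchange_big -sumrN; apply: eq_bigr => u _.
  under eq_bigr => w _ do rewrite mulrAC.
  rewrite -mulr_suml; have /eqP := SP u; rewrite addrC addr_eq0 => /eqP ->.
  by rewrite mulNr mulrC.
under [in RHS]eq_bigr => u _ do rewrite intrD mulrDr.
rewrite big_split /= !(rmorphD, rmorphB, rmorphN, rmorphM) /=.
by field.
Qed.

End Forest.

Notation F2U := {poly 'F_2}.

(* The condition d \o d = 0 plays no role in the definition of filtered chain
   homotopy equivalence and is not recorded. *)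
Record filtered_complex := FilteredComplex {
  chains :> lmodType F2U;
  diff : {linear chains -> chains};
  level : chains -> \bar rat
}.

Arguments diff {_}.
Arguments level {_} _.

Definition filtered (C D : filtered_complex) (phi : C -> D) : Prop :=
  forall x : C, (level (phi x) <= level x)%E.

Definition chain_map (C D : filtered_complex) (phi : C -> D) : Prop :=
  forall x : C, phi (diff x) = diff (phi x).

Definition filtered_homotopic (C D : filtered_complex) (phi psi : C -> D) : Prop :=
  exists2 h : {linear C -> D}, filtered h &
    forall x : C, phi x - psi x = diff (h x) + h (diff x).

Definition filtered_homotopy_equivalent (C D : filtered_complex) : Prop :=
  exists (phi : {linear C -> D}) (psi : {linear D -> C}),
    [/\ chain_map phi /\ filtered phi,
        chain_map psi /\ filtered psi,
        filtered_homotopic (psi \o phi) idfun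
      & filtered_homotopic (phi \o psi) idfun].

Section LatticeComplex.
Variable Gamma : forest.

Definition gen : choiceType := (char Gamma * {set vert Gamma})%type.

Definition CF := {freeg gen / F2U}.
HB.instance Definition _ := GRing.Lmodule.on CF.

Definition boundary_gen (k : gen) : CF :=
  let: (K, E) := k in
  \sum_(u in E) (<< 'X^(aw K E u) *g ((K, E :\ u)%SET : gen) >>
    + << 'X^(bw K E u) *g ((add2dual K (Some u), E :\ u)%SET : gen) >>).

Definition boundary (x : CF) : CF :=
  \sum_(k <- dom x) coeff k x *: boundary_gen k.

Lemma boundaryEw (x : CF) (s : seq gen) : uniq s -> {subset dom x <= s} ->
  boundary x = \sum_(k <- s) coeff k x *: boundary_gen k.
Proof.
move=> Us sub; rewrite /boundary.
rewrite [RHS](bigID (fun k => k \in dom x)) /= [X in _ = _ + X]big1 ?addr0; last first.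
  by move=> k /coeff_outdom ->; rewrite scale0r.
rewrite -[RHS]big_filter; apply: perm_big; apply: uniq_perm.
- exact: uniq_dom.
- exact: filter_uniq.
- by move=> k; rewrite mem_filter andb_idr //; exact: sub.
Qed.

Lemma boundary_is_linear : linear boundary.
Proof.
move=> c x y.
pose s := undup (dom (c *: x + y) ++ dom x ++ dom y).
have Us : uniq s by exact: undup_uniq.
rewrite !(@boundaryEw _ s) //;
  try by move=> k; rewrite mem_undup !mem_cat => ->; rewrite ?orbT.
rewrite scaler_sumr -big_split; apply: eq_bigr => k _.
by rewrite /= coeffD coeffZ scalerDl scalerA.
Qed.

HB.instance Definition _ :=
  GRing.isLinear.Build F2U CF CF *:%R boundary boundary_is_linear.

(* The maximum of A(U^j [K,E]) over the terms U^j [K,E] occurring in x. *)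
Definition knot_level (m : int) (x : CF) : \bar rat :=
  \big[maxe/-oo%E]_(k <- dom x)
    \big[maxe/-oo%E]_(j < size (coeff k x) | (coeff k x)`_j != 0)
      (alexander m j k.1 k.2)%:E.

Definition lattice_complex (m : int) : filtered_complex :=
  @FilteredComplex CF boundary (knot_level m).

End LatticeComplex.

(* [Delta] is isomorphic to the graph obtained from [Gamma] by adding a new
   vertex of framing -1 joined to the vertices in [S], deleting the edges
   between vertices in [S] and decreasing the framings of those by 1. The
   bijection h sends [None] to the new vertex and [Some u] to the vertex u. *)
Definition blowup_at (Gamma Delta : forest) (S : {set option (vert Gamma)}) : Prop :=
  exists2 h : option (vert Gamma) -> vert Delta, bijective h &
    let new := Some (h None) in
    let old := omap (fun u => h (Some u)) in
    [/\ framing (h None) = -1,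
        forall u, framing (h (Some u)) = framing u - (Some u \in S)%:Z,
        forall x, edge new (old x) = (x \in S)
      & forall x y,
          edge (old x) (old y) = edge x y && ~~ ((x \in S) && (y \in S))].

Definition generic_blowup (Gamma Delta : forest) : Prop :=
  blowup_at Delta (set0 : {set option (vert Gamma)}).

Definition vertex_blowup (Gamma Delta : forest) : Prop :=
  exists v : option (vert Gamma), blowup_at Delta [set v]%SET.

Definition edge_blowup (Gamma Delta : forest) : Prop :=
  exists v w : option (vert Gamma), edge v w /\ blowup_at Delta [set v; w]%SET.

Definition is_blowup (Gamma Delta : forest) : Prop :=
  [\/ generic_blowup Gamma Delta, vertex_blowup Gamma Delta
    | edge_blowup Gamma Delta].

Definition differ_by_blowup (Gamma1 Gamma2 : forest) : Prop :=
  is_blowup Gamma1 Gamma2 \/ is_blowup Gamma2 Gamma1.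

(* Main.v *)
From HB Require Import structures.
Require Import Defs.
From mathcomp Require Import boolp constructive_ereal.
From mathcomp Require Import all_boot all_order all_algebra.
From mathcomp Require Import ring lra zify.
From mathcomp.multinomials Require Import freeg.

(** The generators [K,E] are the cubes of a lattice of characteristic vectors,
    with corners K_I = K + 2I^* for I a subset of E.  With q(K) = K^2/8 one
    has f[K,I] = q(K_I) - q(K), so if the weight of a cube is the least value
    of q at its corners, the exponents of U in the differential are the
    differences of weight between a cube and its facets.  Moreover A([K,E]) is
    the weight of [K,E] minus the weight of its translate by 2v_0^*.  Hence a
    map that multiplies every generator by the power of U that makes up for the
    change of weight is filtered as soon as it lowers neither of these two
    weights.

    Let Delta be the blow-up of Gamma at S, with exceptional vertex e, where
    S has at most two elements and these are joined by an edge.  The lattice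
    of Delta is the orthogonal sum of that of Gamma and a line spanned by a
    class of square -1, so a characteristic vector of Delta is a pair of a
    characteristic vector K of Gamma and an odd value 2j+1 on e; j is its
    level.  In weights the line contributes - j(j+1)/2 up to a constant, and
    the corner K + 2I^* lies at the level j raised by the number of elements
    of S in I, and by one more in the translate if v_0 is in S.

    Forgetting e gives a filtered chain map [collapse] from the complex of
    Delta to that of Gamma, which kills the cubes with e as a direction.  For
    fixed K and E the cubes without e as a direction, one for each level j,
    are joined by the cubes with it into a line, and one contracts this line
    to a suitable level, the peak.  The contraction is filtered if both
    weights increase towards the peak, and collapsing the peak costs no power
    of U if both weights are there those of [K,E] in Gamma ([is_peak]).  That
    such a level exists, always -1 or -2, is the heart of the matter
    ([peak_exists]).  If S has at most one element, the function j(j+1)/2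
    vanishes at the levels of all corners when j = -1.  If S = {v,w},
    deleting the edge v w cuts the forest, and on the side that does not
    contain v_0, say that of v, the comparison of the corners with v and
    without v is independent of everything else; it decides between the two
    levels ([peak_cut]).

    The contraction along e inverts only the part of the differential in the
    direction e; the rest lowers the number of the other directions.  So if H
    is the contraction and d the differential, id - (dH + Hd) is a self-map
    homotopic to the identity that is nilpotent on the kernel of [collapse],
    and a power of it turns the inclusion of the peaks into a homotopy inverse
    of [collapse] ([deformation_equivalence]). *)

Set Implicit Arguments.
Unset Strict Implicit.
Unset Printing Implicit Defensive.

Import Order.TTheory GRing.Theory Num.Theory.

Local Open Scope ring_scope.

(** * Deformations of filtered complexes *)

Definition ultrametric (C : filtered_complex) : Prop :=
  forall (r : \bar rat) (x y : C),
    (level x <= r)%E -> (level y <= r)%E -> (level (x - y) <= r)%E.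

Lemma filtered_homotopy_equivalent_sym (C D : filtered_complex) :
  filtered_homotopy_equivalent C D -> filtered_homotopy_equivalent D C.
Proof. by case=> phi [psi [cphi cpsi hC hD]]; exists psi, phi; split. Qed.

Lemma filtered_comp (B C D : filtered_complex) (f : C -> D) (g : B -> C) :
  filtered f -> filtered g -> filtered (f \o g).
Proof. by move=> ff fg x; apply: le_trans (ff _) (fg x). Qed.

Section Deformation.
Variables (C D : filtered_complex).
Variables (phi : {linear C -> D}) (psi : {linear D -> C}) (H : {linear C -> C}).
Variable N : nat.
Hypotheses (ultraC : ultrametric C) (level0D : level (0 : D) = -oo%E).
Hypothesis diffC2 : forall x : C, diff (diff x) = 0.
Hypotheses (diff_filt : filtered (@diff C)) (phi_filt : filtered phi).
Hypotheses (psi_filt : filtered psi) (H_filt : filtered H).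
Hypothesis phi_chain : chain_map phi.
Hypothesis phiK : forall y, phi (psi y) = y.
Hypothesis phiH : forall x, phi (H x) = 0.

Definition deform (x : C) : C := x - (diff (H x) + H (diff x)).

Hypothesis deform_nil : forall x, phi x = 0 -> iter N deform x = 0.

Lemma deform_linear : linear deform.
Proof.
move=> c x y; rewrite /deform (linearP H) (linearP diff) (linearP H) (linearP diff).
by rewrite [X in _ - X]addrACA -scalerDr opprD addrACA -scalerBr.
Qed.
HB.instance Definition _ := GRing.isLinear.Build F2U C C *:%R deform deform_linear.

Lemma ultra_add r (x y : C) :
  (level x <= r)%E -> (level y <= r)%E -> (level (x + y) <= r)%E.
Proof.
move=> lx ly; rewrite -[y]opprK; apply: ultraC => //.
by rewrite -sub0r; apply: ultraC => //; rewrite -(subrr y); apply: ultraC.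
Qed.

Lemma deform_filt : filtered deform.
Proof.
move=> x; apply: ultraC => //; apply: ultra_add.
  exact: le_trans (diff_filt _) (H_filt x).
exact: le_trans (H_filt _) (diff_filt x).
Qed.

Lemma deform_chain : chain_map deform.
Proof.
by move=> x; rewrite /deform (linearB diff) (linearD diff) !diffC2 (linear0 H) addr0 add0r.
Qed.

Lemma phi_deform x : phi (deform x) = phi x.
Proof.
by rewrite /deform (linearB phi) (linearD phi) phi_chain !phiH (linear0 diff) addr0 subr0.
Qed.

(** The powers of a deformation are homotopic to the identity through
    h_(n+1) = h_n o deform - H. *)
Lemma deform_iter n : exists P : {linear C -> C},
  [/\ P =1 iter n deform, filtered P, chain_map P & filtered_homotopic P idfun].
Proof.
elim: n => [|n [P [PE Pf Pc [h hf hE]]]].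
  exists idfun; split=> //; exists (\0 : {linear C -> C}).
    by move=> x /=; rewrite -(subrr x); apply: ultraC.
  by move=> x /=; rewrite subrr linear0 addr0.
exists (P \o deform); split.
- by move=> x; rewrite /= PE -iterSr.
- exact: filtered_comp Pf deform_filt.
- by move=> x; rewrite /= deform_chain Pc.
exists ((h \o deform) \- H).
  move=> x /=; apply: ultraC => //.
  by apply: le_trans (hf _) (deform_filt x).
move=> x /=; rewrite (linearB diff) deform_chain.
have -> : P (deform x) - x = (P (deform x) - deform x) + (deform x - x).
  by rewrite addrA subrK.
have -> : deform x - x = - (diff (H x) + H (diff x)) by rewrite addrC addKr.
by have /= -> := hE (deform x); rewrite opprD addrACA.
Qed.

(** A power P of the deformation vanishes on the kernel of phi, so it factors
    as P = (P o psi) o phi; this makes P o psi a chain map, since phi is onto,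
    and a homotopy inverse of phi. *)
Lemma deformation_equivalence : filtered_homotopy_equivalent C D.
Proof.
have [P [PE Pf Pc Ph]] := deform_iter N.
have P0 x : phi x = 0 -> P x = 0 by rewrite PE; exact: deform_nil.
have Pphi x : P (psi (phi x)) = P x.
  by apply/eqP; rewrite -subr_eq0 -linearB P0 // linearB /= phiK subrr.
have phiP x : phi (P x) = phi x.
  by rewrite PE; elim: N x => //= n IH x; rewrite phi_deform IH.
exists phi, (P \o psi); split=> //.
- split; last exact: filtered_comp.
  by move=> y /=; rewrite -{1}[y]phiK -phi_chain Pphi Pc.
- by case: Ph => h hf hE; exists h => // x /=; rewrite Pphi; apply: hE.
exists (\0 : {linear D -> D}) => y /=; first by rewrite level0D leNye.
by rewrite phiP phiK subrr linear0 addr0.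
Qed.

End Deformation.

(** * Free modules over the polynomial ring *)

Lemma addrr_F2 (M : lmodType F2U) (x : M) : x + x = 0.
Proof.
rewrite -[x]scale1r -scalerDl -polyC1 -polyCD.
have -> : 1 + 1 = 0 :> 'F_2 by apply/val_inj.
by rewrite polyC0 scale0r.
Qed.

Lemma oppr_F2 (M : lmodType F2U) (x : M) : - x = x.
Proof. by apply/eqP; rewrite eq_sym -addr_eq0 addrr_F2. Qed.

Section FreeModule.
Variables (T : choiceType) (M : lmodType F2U).
Local Notation FM := {freeg T / F2U}.
Implicit Types (f : T -> M) (x y : FM).

Lemma scale_genE (c a : F2U) (k : T) : c *: << a *g k >> = << (c * a) *g k >> :> FM.
Proof.
apply/eqP/freeg_eqP => k'.
by rewrite coeffZ !coeffU mulrA.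
Qed.

Lemma fgliftD f : {morph fglift f : x y / x + y}.
Proof.
move=> x y; have fB := lift_is_additive f.
have f0 : fglift f 0 = 0 by rewrite -(subrr x) fB subrr.
have fN z : fglift f (- z) = - fglift f z by rewrite -sub0r fB f0 sub0r.
by rewrite -{1}[y]opprK fB fN opprK.
Qed.

Lemma fglift_linear f : linear (fglift f).
Proof.
move=> c x y; rewrite fgliftD; congr (_ + _).
have fB := lift_is_additive f.
have f0 : fglift f 0 = 0 by rewrite -(subrr x) fB subrr.
rewrite -(freeg_sumE x); elim: (dom x) => [|k s IH].
  by rewrite big_nil scaler0 f0 scaler0.
by rewrite big_cons scalerDr !fgliftD IH scale_genE !liftU scalerDr scalerA.
Qed.

Definition span_map f : FM -> M := fglift f.
HB.instance Definition _ f :=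
  GRing.isLinear.Build F2U FM M *:%R (span_map f) (fglift_linear f).

Lemma span_mapU f (c : F2U) (k : T) : span_map f << c *g k >> = c *: f k.
Proof. exact: liftU. Qed.

Lemma linear_gen_eq (F G : {linear FM -> M}) :
  (forall k, F << k >> = G << k >>) -> F =1 G.
Proof.
move=> FG x; rewrite -(freeg_sumE x) !linear_sum; apply: eq_bigr => k _.
by rewrite -[coeff k x]mulr1 -scale_genE !linearZ /= FG.
Qed.

End FreeModule.

Section Support.
Variable T : choiceType.
Implicit Types (P : T -> nat -> Prop) (x : {freeg T / F2U}).

(** P also sees the exponent of U, since the filtration level of U^n k drops
    as n grows. *)
Definition supported P x := forall k n, (coeff k x)`_n != 0 -> P k n.

Lemma supported0 P : supported P 0.
Proof. by move=> k n; rewrite coeff0 coef0 eqxx. Qed.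

Lemma supportedD P x y : supported P x -> supported P y -> supported P (x + y).
Proof.
move=> Px Py k n; rewrite coeffD coefD.
have [x0|x0 _] := eqVneq (coeff k x)`_n 0; last exact: Px.
by rewrite x0 add0r; apply: Py.
Qed.

Lemma supported_sum P (I : Type) (r : seq I) (Q : pred I) (F : I -> {freeg T / F2U}) :
  (forall i, Q i -> supported P (F i)) -> supported P (\sum_(i <- r | Q i) F i).
Proof.
move=> PF; apply: (big_ind (supported P)) => //; first exact: supported0.
by move=> x y; apply: supportedD.
Qed.

Lemma supportedU P n k : P k n -> supported P << 'X^n *g k >>.
Proof.
move=> Pkn k' n'; rewrite coeffU; case: (k =P k') => [<-|_]; last first.
  by rewrite mulr0 coef0 eqxx.
by rewrite mulr1 coefXn; case: (n' =P n) => [->|_]; rewrite ?eqxx.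
Qed.

Lemma supportedZ (P : T -> Prop) (a : F2U) x :
  supported (fun k _ => P k) x -> supported (fun k _ => P k) (a *: x).
Proof.
move=> Px k n; rewrite coeffZ; have [x0|/eqP x0] := eqVneq (coeff k x) 0.
  by rewrite x0 mulr0 coef0 eqxx.
move=> _; have [i xi] : exists i, (coeff k x)`_i != 0.
  exists (size (coeff k x)).-1; rewrite -lead_coefE lead_coef_eq0; exact/eqP.
exact: Px xi.
Qed.

End Support.

(** A polynomial multiple shifts U-exponents, so a linear map carries a
    support condition over as soon as it does so on basis elements with
    all shifts. *)
Lemma supported_span (T T' : choiceType) (P : T -> nat -> Prop)
    (Q : T' -> nat -> Prop) (F : {linear {freeg T / F2U} -> {freeg T' / F2U}}) x :
  (forall k i, P k i -> supported (fun k' n => Q k' (i + n)%N) (F << k >>)) ->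
  supported P x -> supported Q (F x).
Proof.
move=> FP Px; rewrite -(freeg_sumE x) linear_sum; apply: supported_sum => k _ k' n.
rewrite -[coeff k x]mulr1 -scale_genE linearZ /= coeffZ coefM => nz.
have /existsP [i] : [exists i : 'I_n.+1,
    (coeff k x)`_i * (coeff k' (F << k >>))`_(n - i) != 0].
  apply: contraNT nz; rewrite negb_exists => /forallP all0.
  by apply/eqP/big1 => i _; apply/eqP; have := all0 i; rewrite negbK.
rewrite mulf_eq0 negb_or => /andP [ci Fi].
by have := FP k i (Px _ _ ci) _ _ Fi; rewrite subnKC // -ltnS.
Qed.

Section KnotLevel.
Variables (Gamma : forest) (m : int).

Lemma knot_levelP (r : \bar rat) (x : CF Gamma) :
  (knot_level m x <= r)%E <->
  supported (fun k n => ((alexander m n k.1 k.2)%:E <= r)%E) x.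
Proof.
split=> [xr k n nz|xP].
  have kx : k \in dom x.
    by rewrite mem_dom; apply: contraNneq nz => ->; rewrite coef0.
  have ns : (n < size (coeff k x))%N.
    by rewrite ltnNge; apply: contraNN nz => /(nth_default 0) ->.
  apply: le_trans xr; apply: (bigmax_sup_seq _ k) => //.
  exact: (bigmax_sup (Ordinal ns)).
apply/bigmax_le => [|k _]; first by rewrite leNye.
by apply/bigmax_le => [|i nz]; [rewrite leNye | exact: xP].
Qed.

Lemma lattice_ultrametric : ultrametric (lattice_complex Gamma m).
Proof.
move=> r x y /knot_levelP Px /knot_levelP Py; apply/knot_levelP.
by rewrite [- y]oppr_F2; exact: supportedD.
Qed.

Lemma knot_level0 : knot_level m (0 : CF Gamma) = -oo%E.
Proof. by rewrite /knot_level dom0 big_nil. Qed.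

End KnotLevel.

(** * Weights of cubes and the boundary *)

Section Weights.
Variable Gamma : forest.
Local Notation V := (vert Gamma).
Implicit Types (K : char Gamma) (u w : V) (x y : option V) (E I : {set V}).

Lemma dotC u w : dot (Some u) w = dot (Some w) u.
Proof.
rewrite /dot edge_sym; case: eqP => [[->]|uw]; first by rewrite eqxx.
by case: eqP => // -[wu]; case: uw; rewrite wu.
Qed.

Lemma fw0 K : fw K set0 = 0.
Proof. by have := fwE K set0; rewrite !big_set0; lia. Qed.

Lemma fwU K E I : [disjoint E & I] ->
  fw K (E :|: I) = fw K E + fw K I + \sum_(u in E) \sum_(w in I) dot (Some u) w.
Proof.
move=> dEI; have := fwE K (E :|: I); have := fwE K E; have := fwE K I.
have sumU (F : V -> int) :
    \sum_(u in E :|: I) F u = \sum_(u in E) F u + \sum_(u in I) F u.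
  by rewrite -bigU //; apply: eq_bigl => w; rewrite !inE.
rewrite !sumU; under [X in _ = _ + (X + _)]eq_bigr => u _ do rewrite sumU.
under [X in _ = _ + (_ + X)]eq_bigr => u _ do rewrite sumU.
rewrite !big_split /=.
have -> : \sum_(u in I) \sum_(w in E) dot (Some u) w =
    \sum_(u in E) \sum_(w in I) dot (Some u) w.
  by rewrite exchange_big; apply: eq_bigr => u _; apply: eq_bigr => w _; rewrite dotC.
move=> EI EE EEI; apply: (@mulfI _ (2 : int)) => //.
by rewrite EEI !mulrDr EE EI; ring.
Qed.

Lemma add2dualE K x u : val (add2dual K x) u = val K u + 2 * dot x u.
Proof. by rewrite ffunE. Qed.

Lemma fw_add2dual K x I : fw (add2dual K x) I = fw K I + \sum_(u in I) dot x u.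
Proof.
apply: (@mulfI _ (2 : int)) => //; rewrite mulrDr !fwE.
under eq_bigr => u _ do rewrite add2dualE.
by rewrite big_split /= -mulr_sumr; ring.
Qed.

Lemma fwU1 K u I : u \notin I ->
  fw K (u |: I) = fw K [set u]%SET + fw (add2dual K (Some u)) I.
Proof.
move=> uI; rewrite fwU ?big_set1 ?fw_add2dual ?addrA //.
by rewrite disjoints1.
Qed.

Lemma gw_le K E I : I \subset E -> gw K E <= fw K I.
Proof. exact: bigmin_le_cond. Qed.

Lemma gw_attained K E : exists2 I : {set V}, I \subset E & gw K E = fw K I.
Proof.
apply: (big_ind (fun z => exists2 I : {set V}, I \subset E & z = fw K I)).
- by exists set0; rewrite ?sub0set.
- by move=> a b [I sI ->] [J sJ ->]; rewrite minEle; case: ifP => _;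
    [exists I | exists J].
by move=> I sI; exists I.
Qed.

Lemma le_gw K E z : (forall I : {set V}, I \subset E -> z <= fw K I) -> z <= gw K E.
Proof. by move=> zle; have [I sI ->] := gw_attained K E; apply: zle. Qed.

Lemma BwE K E u :
  Bw K E u = fw K [set u]%SET + gw (add2dual K (Some u)) (E :\ u).
Proof.
have uI (I : {set V}) : I \subset E :\ u -> u \notin I.
  by move/subsetP => sI; apply/negP => /sI; rewrite !inE eqxx.
apply: le_anti; apply/andP; split.
  have [I sI ->] := gw_attained (add2dual K (Some u)) (E :\ u).
  by rewrite -fwU1 ?uI //; apply: bigmin_le_cond.
apply/bigmin_geP; split=> [|I sI]; last by rewrite fwU1 ?uI // lerD2l gw_le.
by rewrite gerDl -(fw0 (add2dual K (Some u))) gw_le // sub0set.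
Qed.

Lemma gw_split K E u : u \in E ->
  gw K E = Num.min (gw K (E :\ u))
    (fw K [set u]%SET + gw (add2dual K (Some u)) (E :\ u)).
Proof.
move=> uE; rewrite -BwE; apply: le_anti.
rewrite le_min (gw_le_Aw K E u) (gw_le_Bw K uE) /= BwE.
have [I sI ->] := gw_attained K E; rewrite ge_min.
have [uI|uI] := boolP (u \in I); last first.
  by rewrite gw_le //; apply/subsetD1P.
rewrite -(setD1K uI) fwU1 ?lerD2l ?gw_le ?orbT //; first exact: setSD.
by rewrite !inE eqxx.
Qed.

(** The cube [K,E] has two facets in the direction u, and e tells them apart:
    their base corners are K and K + 2u^*. *)
Definition corner K u (e : bool) : char Gamma :=
  if e then add2dual K (Some u) else K.

Definition corner_weight K u (e : bool) : int :=
  if e then fw K [set u]%SET else 0.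

(** The exponents a_u and b_u of the differential.  In terms of absolute
    weights this is the weight of the facet minus that of the cube, so that
    exponents add up along a chain of facets. *)
Definition facet_gain K E u e : int :=
  corner_weight K u e + gw (corner K u e) (E :\ u) - gw K E.

Lemma facet_gain_ge0 K E u e : u \in E -> 0 <= facet_gain K E u e.
Proof.
move=> uE; rewrite /facet_gain subr_ge0.
case: e => /=; last by rewrite add0r (gw_le_Aw K E u).
by rewrite -BwE gw_le_Bw.
Qed.

Lemma boundary_genE K E : boundary_gen (K, E) =
  \sum_(u in E) \sum_(e : bool)
    << 'X^(absz (facet_gain K E u e)) *g ((corner K u e, E :\ u)%SET : gen Gamma) >>.
Proof.
apply: eq_bigr => u _; rewrite big_bool /= addrC /aw /bw BwE /facet_gain /=.
by rewrite add0r.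
Qed.

Lemma boundaryU (k : gen Gamma) : boundary << k >> = boundary_gen k.
Proof. by rewrite /boundary domU1 big_seq1 coeffU eqxx mulr1 scale1r. Qed.

Lemma boundaryZ (a : F2U) (k : gen Gamma) : boundary << a *g k >> = a *: boundary_gen k.
Proof.
pose B : {linear CF Gamma -> CF Gamma} := @boundary Gamma.
by rewrite -[in LHS](mulr1 a) -scale_genE -boundaryU; exact: (linearZ_LR B).
Qed.

Lemma add2dualC K x y : add2dual (add2dual K x) y = add2dual (add2dual K y) x.
Proof. by apply/val_inj/ffunP => u; rewrite !add2dualE; lia. Qed.

Lemma cornerC K u w e d : corner (corner K u e) w d = corner (corner K w d) u e.
Proof. by case: e; case: d; rewrite //= add2dualC. Qed.

Lemma corner_weightC K u w e d : u != w ->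
  corner_weight K u e + corner_weight (corner K u e) w d =
  corner_weight K w d + corner_weight (corner K w d) u e.
Proof.
move=> uw; case: e; case: d => //=; rewrite ?addr0 ?add0r //.
by rewrite -!fwU1 ?inE // 1?eq_sym // setUC.
Qed.

End Weights.

(** A double sum of a symmetric function over pairs of distinct elements
    counts every pair twice. *)
Lemma sum_offdiag (T : finType) (M : lmodType F2U) (E : {set T}) (F : T -> T -> M) :
  (forall u w, u != w -> F u w = F w u) -> \sum_(u in E) \sum_(w in E :\ u) F u w = 0.
Proof.
move=> Fsym; pose r (u w : T) := (enum_rank u < enum_rank w)%N.
have -> : \sum_(u in E) \sum_(w in E :\ u) F u w =
    \sum_(u in E) \sum_(w in E | r u w) F u w + \sum_(u in E) \sum_(w in E | r w u) F u w.
  rewrite -big_split; apply: eq_bigr => u _ /=.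
  rewrite (bigID (r u)) /=; congr (_ + _); apply: eq_bigl => w; rewrite !inE /r.
    by have [->|//] := eqVneq w u; rewrite ltnn !andbF.
  have [->|wu] := eqVneq w u; first by rewrite ltnn !andbF.
  rewrite /= -leqNgt ltn_neqAle; case: eqP => [/val_inj/enum_rank_inj E'|_] //=.
  by rewrite E' eqxx in wu.
rewrite [X in _ + X](exchange_big_dep (mem E)) /=; last by move=> u w _ /andP [].
rewrite [X in _ + X](_ : _ = \sum_(u in E) \sum_(w in E | r u w) F u w) ?addrr_F2 //.
apply: eq_big => // u uE; apply: eq_big => [w|w /andP [_ /andP [_ ruw]]].
  by rewrite [u \in E]uE.
by apply: Fsym; apply: contraTneq ruw => ->; rewrite /r ltnn.
Qed.

(** Removing u and then w leads to the same cubes, with the same total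
    exponents, as removing w and then u. *)
Lemma boundary_boundary (Gamma : forest) (x : CF Gamma) : boundary (boundary x) = 0.
Proof.
pose Z : {linear CF Gamma -> CF Gamma} := \0.
pose B : {linear CF Gamma -> CF Gamma} := @boundary Gamma \o @boundary Gamma.
rewrite -[RHS]/(Z x); apply: (linear_gen_eq (F := B)) => -[K E] /=.
rewrite boundaryU boundary_genE linear_sum /=.
pose F u w : CF Gamma := \sum_(e : bool) \sum_(d : bool)
  << 'X^(absz (corner_weight K u e + corner_weight (corner K u e) w d
              + gw (corner (corner K u e) w d) (E :\ u :\ w) - gw K E)%R)
     *g ((corner (corner K u e) w d, E :\ u :\ w)%SET : gen Gamma) >>.
transitivity (\sum_(u in E) \sum_(w in E :\ u) F u w).
  apply: eq_bigr => u uE; rewrite linear_sum exchange_big /=; apply: eq_bigr => e _.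
  rewrite boundaryZ boundary_genE scaler_sumr; apply: eq_bigr => w wE.
  rewrite scaler_sumr; apply: eq_bigr => d _; rewrite scale_genE -exprD.
  have := facet_gain_ge0 K e uE; have := facet_gain_ge0 (corner K u e) d wE.
  by rewrite /facet_gain => g1 g2; congr (<< 'X^_ *g _ >>); lia.
apply: sum_offdiag => u w uw; rewrite /F exchange_big /=.
apply: eq_bigr => d _; apply: eq_bigr => e _.
rewrite corner_weightC // cornerC.
by have -> : E :\ u :\ w = E :\ w :\ u by rewrite !setDDl setUC.
Qed.

(** * The knot filtration *)

Lemma alexanderD (Gamma : forest) (m : int) (i n : nat) (K : char Gamma)
    (E : {set vert Gamma}) :
  alexander m (i + n) K E = alexander m n K E - i%:R.
Proof. by rewrite /alexander natrD; ring. Qed.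

Lemma filtered_gen (Gamma Delta : forest) (m m' : int)
    (F : {linear CF Gamma -> CF Delta}) :
  (forall K E, supported (fun k n => alexander m' n k.1 k.2 <= alexander m 0 K E)
                 (F << ((K, E) : gen Gamma) >>)) ->
  filtered (F : lattice_complex Gamma m -> lattice_complex Delta m').
Proof.
move=> FP x; apply/knot_levelP.
apply: (@supported_span _ _ (fun k n => ((alexander m n k.1 k.2)%:E <= knot_level m x)%E)).
  move=> [K E] i /= Ei k' n /(FP K E k' n) nE; apply: le_trans Ei.
  have -> : alexander m i K E = alexander m 0 K E - i%:R by rewrite -alexanderD addn0.
  by rewrite lee_fin alexanderD lerD2r.
by apply/knot_levelP.
Qed.

Section KnotHeight.
Variable Gamma : forest.
Hypothesis nd : negative_definite Gamma.
Local Notation V := (vert Gamma).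
Implicit Types (K : char Gamma) (E : {set V}) (u : V).

(** With q(K) = K^2/8 and K' = K + 2v_0^* this is q(K) - q(K'), which turns the
    difference of relative weights in the Alexander filtration into a
    difference of absolute ones. *)
Definition spinc_height K : rat :=
  (\sum_u Sigma Gamma u * (val K u + dot None u)%:~R) / 2.

Lemma alexander_gw m n K E : alexander m n K E =
  (gw K E - gw (add2dual K None) E - n%:Z)%:~R + spinc_height K.
Proof.
by rewrite alexanderE // /spinc_height !intrD !intrN -pmulrn; ring.
Qed.

Lemma spinc_height_corner K u :
  spinc_height (add2dual K (Some u)) = spinc_height K - (dot None u)%:~R.
Proof.
have <- : \sum_w Sigma Gamma w * (dot (Some w) u)%:~R = - (dot None u)%:~R :> rat.
  by apply/eqP; rewrite -addr_eq0 addrC SigmaP.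
rewrite /spinc_height; set s := \sum_w _ * (dot _ u)%:~R.
under eq_bigr => w _ do rewrite add2dualE addrAC intrD mulrDr.
rewrite big_split /=; set t := (X in (_ + X) / 2).
have -> : t = s * 2.
  rewrite mulr_suml; apply: eq_bigr => w _.
  by rewrite dotC intrM mulrCA mulrC.
by rewrite mulrDl mulfK.
Qed.

(** The power of U keeps the weight of the cube fixed, and the weight of the
    translate by 2v_0^* does not drop on a facet. *)
Lemma facet_height K E u e :
  u \in E ->
  (gw (corner K u e) (E :\ u) - gw (add2dual (corner K u e) None) (E :\ u)
     - facet_gain K E u e)%:~R + spinc_height (corner K u e)
  <= (gw K E - gw (add2dual K None) E)%:~R + spinc_height K.
Proof.
move=> uE; have := facet_gain_ge0 (add2dual K None) e uE; rewrite /facet_gain.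
case: e => /= g1; last first.
  by rewrite lerD2r ler_int; lia.
rewrite spinc_height_corner addrCA addrC lerD2r -intrB ler_int.
have := fw_add2dual K None [set u]; rewrite big_set1 => fE.
rewrite add2dualC; lia.
Qed.

Lemma boundary_filtered (m : int) : filtered (@diff (lattice_complex Gamma m)).
Proof.
apply: filtered_gen => K E /=; rewrite boundaryU boundary_genE.
apply: supported_sum => u uE; apply: supported_sum => e _; apply: supportedU => /=.
rewrite !alexander_gw subr0; apply: le_trans (facet_height K e uE).
by rewrite lerD2r ler_int; have := facet_gain_ge0 K e uE; lia.
Qed.

End KnotHeight.

(** * Cutting a forest at an edge *)

(** As X is a set of vertices of G, the vertex v_0 is on the side of w. *)
Definition cuts (Gamma : forest) (v : vert Gamma) (w : option (vert Gamma))
    (X : {set vert Gamma}) : Prop :=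
  [/\ v \in X, (forall u, u \in X -> Some u != w)
    & forall u z, u \in X -> (forall t, t \in X -> Some t != z) ->
        edge z (Some u) = (u == v) && (z == w)].

(** Removing an edge from a forest separates its end points, so v_0 is cut
    off from one of them. *)
Lemma forest_cut (Gamma : forest) (x y : option (vert Gamma)) : edge x y ->
  exists v w X, [set x; y] = [set Some v; w] /\ cuts v w X.
Proof.
move=> exy; have xy : x != y by apply: contraTneq exy => ->; rewrite edge_irr.
pose e := [rel a b : option (vert Gamma) | edge a b && ([set a; b] != [set x; y])].
have e_sym : connect_sym e.
  by apply: sym_connect_sym => a b; rewrite /= edge_sym setUC.
have nxy : ~~ connect e x y.
  (* a path from x to y that avoids the edge x y would close up to a cycle *)
  apply/connectP => -[p xp yp].
  move: yp; case/shortenP: xp => q xq q_uniq _ yq.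
  have /edge_acyclic : ucycle (@edge Gamma) (x :: q).
    rewrite /ucycle q_uniq andbT /= rcons_path -yq edge_sym exy andbT.
    by apply: sub_path xq => a b /andP [].
  case: q xq yq {q_uniq} => [|z [|//]] /=; first by move=> _ yx; rewrite yx eqxx in xy.
  by move=> /andP [/andP [_ ne] _] yz; rewrite -yz eqxx in ne.
have cut v w : [set x; y] = [set Some v; w] -> ~~ connect e (Some v) w ->
    ~~ connect e (Some v) None ->
    exists v w X, [set x; y] = [set Some v; w] /\ cuts v w X.
  move=> Exy nvw nv0; exists v, w, [set u | connect e (Some v) (Some u)]; split=> //; split.
  - by rewrite inE connect0.
  - by move=> u; rewrite inE => vu; apply: contraNneq nvw => <-.
  move=> u z; rewrite inE => vu zX.
  have nvz : ~~ connect e (Some v) z.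
    case: z zX => [t|//] zX; apply/negP => vt.
    by have := zX t; rewrite inE eqxx => /(_ vt).
  have nuz : e (Some u) z = false.
    by apply: contraNF nvz => uz; apply: (connect_trans vu); apply: connect1.
  have evw : edge (Some v) w.
    have := set21 x y; have := set22 x y; rewrite Exy !inE.
    move=> /orP [] /eqP yE /orP [] /eqP xE; rewrite xE yE ?eqxx // in exy xy.
    by rewrite edge_sym.
  apply/idP/andP => [ezu|[/eqP -> /eqP ->]]; last by rewrite edge_sym.
  have /eqP Euz : [set Some u; z] == [set x; y].
    by move: nuz; rewrite /= edge_sym ezu /= => /negbFE.
  have uzE : Some u \in [set Some v; w] by rewrite -Exy -Euz set21.
  have zE : z \in [set Some v; w] by rewrite -Exy -Euz set22.
  move: uzE zE; rewrite !inE => /orP [/eqP [->]|/eqP uw].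
    by rewrite eqxx => /orP [/eqP zv|/eqP ->] //; rewrite zv connect0 in nvz.
  by rewrite -uw vu in nvw.
have {cut} cut a b : [set x; y] = [set a; b] -> ~~ connect e a b -> ~~ connect e a None ->
    exists v w X, [set x; y] = [set Some v; w] /\ cuts v w X.
  by case: a => [a|]; [exact: cut | rewrite connect0].
have [x0|nx0] := boolP (connect e x None); last exact: cut nxy nx0.
apply: (cut y x); first by rewrite setUC.
  by rewrite e_sym.
by apply: contraNN nxy => y0; apply: (connect_trans x0); rewrite e_sym.
Qed.

(** * Characteristic vectors of a blow-up *)

Lemma sum_option (T : finType) (R : nmodType) (F : option T -> R) :
  \sum_x F x = F None + \sum_u F (Some u).
Proof.
rewrite (bigD1 None) //= (reindex_omap Some id) /=; last by case.
by congr (_ + _); apply: eq_bigl => u; rewrite eqxx.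
Qed.

(** As (2j+1)^2/8 = tri j + 1/8, this is, up to sign and a constant, the
    contribution to the weight of the line spanned by the exceptional class
    when the characteristic vector takes the value 2j+1 on it. *)
Definition tri (j : int) : int := ((j * (j + 1)) %/ 2)%Z.

Lemma triE j : 2 * tri j = j * (j + 1).
Proof.
rewrite /tri mulrC divzK //.
have [q [->|->]] : exists q, j = 2 * q \/ j = 2 * q + 1.
- by exists (j %/ 2)%Z; lia.
- by rewrite -mulrA dvdz_mulr.
by apply/dvdzP; exists ((2 * q + 1) * (q + 1)); ring.
Qed.

Lemma triS j : tri (j + 1) = tri j + j + 1.
Proof. by have := triE j; have := triE (j + 1); nia. Qed.

Lemma tri_ge0 j : 0 <= tri j.
Proof. by have := triE j; nia. Qed.

Section Blowup.
Variables (Gamma Delta : forest) (S : {set option (vert Gamma)}).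
Variables (h : option (vert Gamma) -> vert Delta) (hi : vert Delta -> option (vert Gamma)).
Hypotheses (hK : cancel h hi) (hiK : cancel hi h).
Local Notation V := (vert Gamma).
Local Notation ex := (h None).
Local Notation old := (omap (fun u => h (Some u))).
Hypothesis framing_ex : framing ex = -1.
Hypothesis framing_old : forall u, framing (h (Some u)) = framing u - (Some u \in S)%:Z.
Hypothesis edge_ex : forall x, edge (Some ex) (old x) = (x \in S).
Hypothesis edge_old : forall x y,
  edge (old x) (old y) = edge x y && ~~ ((x \in S) && (y \in S)).
Hypothesis S_clique : forall x y, x \in S -> y \in S -> x != y -> edge x y.

Implicit Types (K : char Gamma) (u w : V) (x y : option V) (E I : {set V}).
Implicit Types (j k : int) (b : bool).

Definition inS x : int := (x \in S)%:Z.

Lemma h_inj : injective h. Proof. exact: can_inj hK. Qed.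

Lemma sum_blowup (R : nmodType) (F : vert Delta -> R) :
  \sum_y F y = F ex + \sum_u F (h (Some u)).
Proof. by rewrite (reindex h) ?sum_option //; exists hi => x _. Qed.

Lemma dot_ex : dot (Some ex) ex = -1.
Proof. by rewrite /dot eqxx. Qed.

Lemma dot_ex_old u : dot (Some ex) (h (Some u)) = inS (Some u).
Proof.
rewrite /dot (inj_eq Some_inj) (inj_eq h_inj) /=.
by rewrite -[Some (h (Some u))]/(old (Some u)) edge_ex.
Qed.

Lemma dot_old_ex x : dot (old x) ex = inS x.
Proof.
rewrite /dot edge_sym edge_ex; case: x => [u|] //=.
by rewrite (inj_eq Some_inj) (inj_eq h_inj).
Qed.

(** For two vertices of S an edge disappears, for one vertex of S the framing
    decreases: the product drops by 1 in both cases. *)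
Lemma dot_old x w : dot (old x) (h (Some w)) = dot x w - inS x * inS (Some w).
Proof.
rewrite /dot /inS; have -> : (old x == Some (h (Some w))) = (x == Some w).
  by case: x => [u|] //=; rewrite !(inj_eq Some_inj) (inj_eq h_inj).
have [->|xw] := eqVneq x (Some w); first by rewrite framing_old -PoszM mulnb andbb.
rewrite -[Some (h (Some w))]/(old (Some w)) edge_old -PoszM mulnb.
have [xS|] := boolP (x \in S); have [wS|] := boolP (Some w \in S);
  rewrite ?andbT ?subr0 //=.
by rewrite S_clique.
Qed.

(** The vertex u of Gamma corresponds to the class h u + [u in S] e, which is
    orthogonal to the exceptional class e; this splits a characteristic vector
    of Delta into one of Gamma and the odd value 2j+1 on e. *)
Definition lift_fun K j : {ffun vert Delta -> int} :=
  [ffun y => if hi y is Some u then val K u - inS (Some u) * (2 * j + 1)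
             else 2 * j + 1].

Lemma lift_ex K j : lift_fun K j ex = 2 * j + 1.
Proof. by rewrite ffunE hK. Qed.

Lemma lift_old K j u : lift_fun K j (h (Some u)) = val K u - inS (Some u) * (2 * j + 1).
Proof. by rewrite ffunE hK. Qed.

Definition restrict (x : {ffun vert Delta -> int}) : {ffun V -> int} :=
  [ffun u => x (h (Some u))].

Definition S_mass (z : {ffun V -> int}) : int := \sum_u z u * inS (Some u).

Lemma H2eval_blowup (K x : {ffun vert Delta -> int}) :
  H2eval K x = x ex * K ex + \sum_u x (h (Some u)) * K (h (Some u)).
Proof. exact: sum_blowup. Qed.

(** Blowing up changes the lattice into an orthogonal sum with a line
    spanned by a class of square -1. *)
Lemma H2dot_blowup (x : {ffun vert Delta -> int}) :
  H2dot x x = H2dot (restrict x) (restrict x)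
              - (x ex - S_mass (restrict x)) * (x ex - S_mass (restrict x)).
Proof.
set z := restrict x; have zE u : x (h (Some u)) = z u by rewrite ffunE.
rewrite /H2dot !sum_blowup dot_ex.
under [X in _ + X = _]eq_bigr => u _ do rewrite sum_blowup (dot_old_ex (Some u)).
rewrite big_split /=.
have -> : \sum_u x ex * x (h (Some u)) * dot (Some ex) (h (Some u)) = x ex * S_mass z.
  by rewrite mulr_sumr; apply: eq_bigr => u _; rewrite dot_ex_old zE mulrA.
have -> : \sum_u x (h (Some u)) * x ex * inS (Some u) = x ex * S_mass z.
  by rewrite mulr_sumr; apply: eq_bigr => u _; rewrite zE mulrAC mulrC.
have -> : \sum_u \sum_w x (h (Some u)) * x (h (Some w)) * dot (Some (h (Some u))) (h (Some w))
    = \sum_u \sum_w z u * z w * dot (Some u) w - S_mass z * S_mass z.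
  rewrite /S_mass mulr_suml -sumrB; apply: eq_bigr => u _.
  rewrite mulr_sumr -sumrB; apply: eq_bigr => w _.
  by rewrite !zE (dot_old (Some u)); ring.
ring.
Qed.

Lemma lift_characteristic K j : characteristic (lift_fun K j).
Proof.
move=> x; rewrite H2dot_blowup H2eval_blowup lift_ex; set z := restrict x.
have -> : \sum_u x (h (Some u)) * lift_fun K j (h (Some u))
    = H2eval (val K) z - S_mass z * (2 * j + 1).
  rewrite /S_mass mulr_suml -sumrB; apply: eq_bigr => u _.
  by rewrite lift_old ffunE; ring.
have := charP K z; move: (H2eval _ _) (H2dot _ _) (S_mass z) (x ex) => a b s t.
have := triE (t - s); move: (tri _) => T TE ab.
(* an odd multiple of t - s is congruent to (t - s)^2 modulo 2 *)
have -> : t * (2 * j + 1) + (a - s * (2 * j + 1))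
    = a - (t - s) * (t - s) + 2 * ((t - s) * j + T).
  by rewrite !mulrDr TE; ring.
lia.
Qed.

Definition lift K j : char Delta :=
  Sub (lift_fun K j) (introT (asboolP _) (lift_characteristic K j)).

Lemma val_lift K j : val (lift K j) = lift_fun K j. Proof. by []. Qed.

Lemma odd_ex (L : char Delta) : exists j, val L ex = 2 * j + 1.
Proof.
have := charP L [ffun y => (y == ex)%:R].
rewrite H2dot_blowup H2eval_blowup.
have -> : restrict [ffun y => (y == ex)%:R] = [ffun=> 0].
  by apply/ffunP => u; rewrite !ffunE (inj_eq h_inj).
rewrite /S_mass /H2dot !big1 => [|u _|u _|u _].
- rewrite ffunE eqxx => LE; exists ((val L ex) %/ 2)%Z; move: LE; lia.
- by rewrite ffunE mul0r.
- by rewrite big1 // => w _; rewrite ffunE !mul0r.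
by rewrite ffunE (inj_eq h_inj) mul0r.
Qed.

Definition proj_fun (L : char Delta) : {ffun V -> int} :=
  [ffun u => val L (h (Some u)) + inS (Some u) * val L ex].

Lemma proj_characteristic (L : char Delta) : characteristic (proj_fun L).
Proof.
move=> z; pose x : {ffun vert Delta -> int} :=
  [ffun y => if hi y is Some u then z u else S_mass z].
have xz : restrict x = z by apply/ffunP => u; rewrite !ffunE hK.
have xe : x ex = S_mass z by rewrite ffunE hK.
have := charP L x; rewrite H2dot_blowup H2eval_blowup xz xe subrr mul0r subr0 => <-.
congr (_ %% _)%Z; rewrite /S_mass mulr_suml -big_split; apply: eq_bigr => u _.
by rewrite !ffunE hK /=; ring.
Qed.

Definition proj (L : char Delta) : char Gamma :=
  Sub (proj_fun L) (introT (asboolP _) (proj_characteristic L)).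

Definition height (L : char Delta) : int := ((val L ex - 1) %/ 2)%Z.

Lemma liftK K j : proj (lift K j) = K.
Proof.
by apply/val_inj/ffunP => u; rewrite ffunE !val_lift lift_ex lift_old subrK.
Qed.

Lemma height_lift K j : height (lift K j) = j.
Proof. by rewrite /height val_lift lift_ex; lia. Qed.

Lemma projK (L : char Delta) : lift (proj L) (height L) = L.
Proof.
have [j jE] := odd_ex L; apply/val_inj/ffunP => y.
have hj : height L = j by rewrite /height jE; lia.
rewrite val_lift -[y]hiK hj; case: (hi y) => [u|]; last by rewrite lift_ex jE.
by rewrite lift_old ffunE jE addrK.
Qed.

Lemma lift_add2dual_ex K j : add2dual (lift K j) (Some ex) = lift K (j - 1).
Proof.
apply/val_inj/ffunP => y; rewrite add2dualE !val_lift -[y]hiK.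
case: (hi y) => [u|]; last by rewrite !lift_ex dot_ex; ring.
by rewrite !lift_old dot_ex_old; ring.
Qed.

Lemma lift_add2dual_old K j x : add2dual (lift K j) (old x) = lift (add2dual K x) (j + inS x).
Proof.
apply/val_inj/ffunP => y; rewrite add2dualE !val_lift -[y]hiK.
case: (hi y) => [u|]; last by rewrite !lift_ex dot_old_ex; ring.
by rewrite !lift_old add2dualE dot_old; ring.
Qed.

(** b tells whether the exceptional vertex is one of the directions. *)
Definition lift_set E b : {set vert Delta} :=
  [set y | if hi y is Some u then u \in E else b].

Definition proj_set (E : {set vert Delta}) : {set V} := [set u | h (Some u) \in E].

Lemma lift_set_old E b u : (h (Some u) \in lift_set E b) = (u \in E).
Proof. by rewrite inE hK. Qed.

Lemma lift_set_ex E b : (ex \in lift_set E b) = b.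
Proof. by rewrite inE hK. Qed.

Lemma lift_setK E b : proj_set (lift_set E b) = E.
Proof. by apply/setP => u; rewrite inE lift_set_old. Qed.

Lemma proj_setK (E : {set vert Delta}) : lift_set (proj_set E) (ex \in E) = E.
Proof.
apply/setP => y; rewrite -[y]hiK; case: (hi y) => [u|].
  by rewrite lift_set_old inE.
by rewrite lift_set_ex.
Qed.

Lemma lift_setD_ex E : lift_set E true :\ ex = lift_set E false.
Proof.
apply/setP => y; rewrite -[y]hiK; case: (hi y) => [u|].
  by rewrite in_setD1 !lift_set_old (inj_eq h_inj).
by rewrite in_setD1 !lift_set_ex eqxx.
Qed.

Lemma lift_setD_old E b u : lift_set E b :\ h (Some u) = lift_set (E :\ u) b.
Proof.
apply/setP => y; rewrite -[y]hiK in_setD1 (inj_eq h_inj); case: (hi y) => [w|].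
  by rewrite !lift_set_old in_setD1 (inj_eq Some_inj).
by rewrite !lift_set_ex.
Qed.

Lemma sum_lift_set (R : nmodType) (F : vert Delta -> R) E b :
  \sum_(y in lift_set E b) F y = (if b then F ex else 0) + \sum_(u in E) F (h (Some u)).
Proof.
rewrite big_mkcond sum_blowup lift_set_ex [in RHS]big_mkcond; congr (_ + _).
by apply: eq_bigr => u _; rewrite lift_set_old.
Qed.

(** * Weights of the cubes of a blow-up *)

(** Adding 2u^* for u in S raises the level by 1, so this is the rise in level
    from K to the corner K + 2I^*. *)
Definition S_count I : int := \sum_(u in I) inS (Some u).

(** The corner of level j + S_count I loses the value of tri there. *)
Lemma fw_lift K j I :
  fw (lift K j) (lift_set I false) = fw K I - tri (j + S_count I) + tri j.
Proof.
apply: (@mulfI _ (2 : int)) => //; rewrite !mulrDr mulrN !triE !fwE.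
rewrite !sum_lift_set !add0r; set s := S_count I.
under eq_bigr => u _ do rewrite val_lift lift_old.
under [X in _ + X = _]eq_bigr => u _.
  rewrite sum_lift_set add0r.
  under eq_bigr => w _ do rewrite (dot_old (Some u)).
  rewrite sumrB -mulr_sumr -/(S_count I) -/s.
over.
by rewrite !sumrB -!mulr_suml -/(S_count I) -/s; ring.
Qed.

Lemma fw_lift_ex K j : fw (lift K j) [set ex] = j.
Proof.
apply: (@mulfI _ (2 : int)) => //.
by rewrite fwE !big_set1 val_lift lift_ex dot_ex; ring.
Qed.

(** The weight of a cube of the blow-up, normalised by tri j so that it
    can be compared with weights of cubes of Gamma. *)
Definition lift_weight K j E b : int := gw (lift K j) (lift_set E b) - tri j.

Lemma lift_weight_le K j E I : I \subset E ->
  lift_weight K j E false <= fw K I - tri (j + S_count I).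
Proof.
move=> IE; rewrite lerBlDr -fw_lift; apply: gw_le; apply/subsetP => y.
rewrite -[y]hiK; case: (hi y) => [u|]; last by rewrite !lift_set_ex.
by rewrite !lift_set_old; apply/subsetP.
Qed.

Lemma lift_weight_attained K j E : exists2 I : {set V}, I \subset E &
  lift_weight K j E false = fw K I - tri (j + S_count I).
Proof.
have [J JE gE] := gw_attained (lift K j) (lift_set E false).
have exJ : (ex \in J) = false.
  by apply/negP => /(subsetP JE); rewrite lift_set_ex.
exists (proj_set J).
  by apply/subsetP => u; rewrite inE => /(subsetP JE); rewrite lift_set_old.
by rewrite /lift_weight gE -[in LHS](proj_setK J) exJ fw_lift addrK.
Qed.

(** In the direction of the exceptional vertex a cube extends from level j down
    to level j - 1. *)
Lemma lift_weight_split K j E : lift_weight K j E true =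
  Num.min (lift_weight K j E false) (lift_weight K (j - 1) E false).
Proof.
rewrite /lift_weight (@gw_split _ _ _ ex) ?lift_set_ex // lift_setD_ex.
rewrite fw_lift_ex lift_add2dual_ex.
have := triS (j - 1); rewrite subrK => tE.
have -> : gw (lift K (j - 1)) (lift_set E false) - tri (j - 1)
  = j + gw (lift K (j - 1)) (lift_set E false) - tri j by rewrite tE; ring.
by rewrite addr_minl.
Qed.

Lemma facet_gain_old K j E b u e :
  facet_gain (lift K j) (lift_set E b) (h (Some u)) e =
  corner_weight K u e + lift_weight (corner K u e) (j + inS (Some u) *+ e) (E :\ u) b
  - lift_weight K j E b.
Proof.
rewrite /facet_gain /lift_weight lift_setD_old.
case: e => /=; last by rewrite mulr0n addr0; ring.
have <- : lift_set [set u] false = [set h (Some u)].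
  by rewrite -[RHS]proj_setK; congr lift_set;
    [apply/setP => w | ]; rewrite !inE !(inj_eq h_inj) ?(inj_eq Some_inj).
rewrite fw_lift /S_count big_set1 (lift_add2dual_old K j (Some u)) mulr1n.
ring.
Qed.

Lemma facet_gain_ex K j E e :
  facet_gain (lift K j) (lift_set E true) ex e =
  lift_weight K (j - e%:Z) E false - lift_weight K j E true.
Proof.
rewrite /facet_gain /lift_weight lift_setD_ex.
case: e => /=; last by rewrite subr0; ring.
rewrite fw_lift_ex lift_add2dual_ex.
have := triS (j - 1); rewrite subrK => ->; ring.
Qed.

Lemma corner_old K j u e :
  corner (lift K j) (h (Some u)) e = lift (corner K u e) (j + inS (Some u) *+ e).
Proof. by case: e; rewrite /= ?mulr0n ?addr0 // (lift_add2dual_old K j (Some u)). Qed.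

Lemma corner_ex K j e : corner (lift K j) ex e = lift K (j - e%:Z).
Proof. by case: e; rewrite /= ?subr0 ?lift_add2dual_ex. Qed.

(** * The knot filtration of a blow-up *)

Section Knot.
Hypotheses (nd : negative_definite Gamma) (nd' : negative_definite Delta).

(** The class Sigma of Gamma is orthogonal to e as well, so it is that of Delta;
    only the basis in which it is written changes. *)
Lemma Sigma_blowup :
  (forall u, Sigma Delta (h (Some u)) = Sigma Gamma u) /\
  Sigma Delta ex = (inS None)%:~R + \sum_u Sigma Gamma u * (inS (Some u))%:~R.
Proof.
pose c : {ffun vert Delta -> rat} :=
  [ffun y => if hi y is Some u then Sigma Gamma u
             else (inS None)%:~R + \sum_u Sigma Gamma u * (inS (Some u))%:~R].
have c_old u : c (h (Some u)) = Sigma Gamma u by rewrite ffunE hK.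
have c_ex : c ex = (inS None)%:~R + \sum_u Sigma Gamma u * (inS (Some u))%:~R.
  by rewrite ffunE hK.
have cP : Sigma_spec c.
  move=> y; rewrite -[y]hiK sum_blowup.
  under eq_bigr => u _ do rewrite c_old.
  rewrite c_ex.
  case: (hi y) => [w|].
    under eq_bigr => u _ do rewrite (dot_old (Some u)) intrB intrM mulrBr mulrA.
    rewrite sumrB -mulr_suml dot_ex_old (dot_old None) intrB intrM.
    by rewrite -[RHS](SigmaP nd w); ring.
  under eq_bigr => u _ do rewrite (dot_old_ex (Some u)).
  by rewrite dot_ex (dot_old_ex None); ring.
have [a [_ a_uniq]] := Sigma_exists_unique nd'.
have -> : Sigma Delta = c by rewrite -(a_uniq _ (SigmaP nd')) -(a_uniq _ cP).
by split.
Qed.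

Lemma spinc_height_lift K j :
  spinc_height (lift K j) = spinc_height K + (inS None * (j + 1))%:~R.
Proof.
have [Sold Sex] := Sigma_blowup.
rewrite /spinc_height sum_blowup val_lift lift_ex (dot_old_ex None).
under eq_bigr => u _ do rewrite Sold lift_old (dot_old None).
rewrite Sex.
have -> : \sum_u Sigma Gamma u * (val K u - inS (Some u) * (2 * j + 1)
      + (dot None u - inS None * inS (Some u)))%:~R
    = \sum_u Sigma Gamma u * (val K u + dot None u)%:~R
      - (\sum_u Sigma Gamma u * (inS (Some u))%:~R) * (2 * j + 1 + inS None)%:~R :> rat.
  rewrite mulr_suml -sumrB; apply: eq_bigr => u _.
  by rewrite !(intrD, intrB, intrM, rmorphN); ring.
(* the two sides agree because inS None is its own square *)
have [->|->] : inS None = 0 \/ inS None = 1 by rewrite /inS; case: in_mem; [right|left].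
  by rewrite !(intrD, intrM); field.
by rewrite !(intrD, intrM); field.
Qed.

(** The weight of the translate by 2v_0^*; when v_0 is in S the translation
    raises the level. *)
Definition knot_weight K j E b : int :=
  lift_weight (add2dual K None) (j + inS None) E b.

(** The same formula as for the cubes of Gamma: a map that preserves K and
    lowers neither lift_weight nor knot_weight is filtered. *)
Lemma alexander_lift m n K j E b : alexander m n (lift K j) (lift_set E b) =
  (lift_weight K j E b - knot_weight K j E b - n%:Z)%:~R + spinc_height K.
Proof.
rewrite alexander_gw // spinc_height_lift (lift_add2dual_old K j None).
rewrite addrCA addrC -intrD; congr (_%:~R + _).
rewrite /knot_weight /lift_weight.
have [->|->] : inS None = 0 \/ inS None = 1 by rewrite /inS; case: in_mem; [right|left].
  by rewrite !addr0; ring.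
by rewrite triS; ring.
Qed.

End Knot.

(** * The peak of the two weights *)

Section Peak.
Hypothesis S_card : (#|S| <= 2)%N.

Lemma inS_ge0 x : 0 <= inS x. Proof. by []. Qed.

Lemma S_count_ge0 I : 0 <= S_count I.
Proof. exact: sumr_ge0. Qed.

Lemma S_count_le_card I : S_count I + inS None <= #|S|%:Z.
Proof.
have cardS : inS None + \sum_u inS (Some u) = #|S|%:Z.
  rewrite -sum_option -sum1_card (big_morph Posz PoszD (erefl _)) [RHS]big_mkcond.
  by apply: eq_bigr => x _; rewrite /inS; case: (x \in S).
have leI : S_count I <= \sum_u inS (Some u).
  by rewrite /S_count big_mkcond; apply: ler_sum => u _; case: ifP.
by rewrite -cardS addrC lerD2l.
Qed.

Lemma S_count_le I : S_count I + inS None <= 2.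
Proof. by apply: le_trans (S_count_le_card I) _. Qed.

(** All corners, those of the translate included, lie at most two levels above
    the base corner; the bound on j keeps them where tri does not increase. *)
Lemma lift_weight_up K j E : j <= inS None - 3 ->
  lift_weight K j E false <= lift_weight K (j + 1) E false.
Proof.
move=> jle; have [I IE ->] := lift_weight_attained K (j + 1) E.
apply: le_trans (lift_weight_le K j IE) _; rewrite lerD2l lerN2.
rewrite addrAC triS; have := S_count_le I; move: (tri _) jle; lia.
Qed.

Lemma lift_weight_down K j E : -1 <= j ->
  lift_weight K (j + 1) E false <= lift_weight K j E false.
Proof.
move=> jge; have [I IE ->] := lift_weight_attained K j E.
apply: le_trans (lift_weight_le K (j + 1) IE) _; rewrite lerD2l lerN2.
rewrite addrAC triS; have := S_count_ge0 I; move: (tri _) jge; lia.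
Qed.

Lemma lift_weight_le_gw K j E : lift_weight K j E false <= gw K E.
Proof.
apply: le_gw => I IE; apply: le_trans (lift_weight_le K j IE) _.
by rewrite gerDl oppr_le0 tri_ge0.
Qed.

(** b selects between the weight of a cube and that of its translate, which
    then share their proofs. *)
Definition twist K b : char Gamma := if b then add2dual K None else K.

Lemma lift_weight_twist K j E b :
  (forall I : {set V}, I \subset E -> exists2 J : {set V}, J \subset E &
     fw (twist K b) J <= fw (twist K b) I - tri (j + inS None *+ b + S_count I)) ->
  lift_weight (twist K b) (j + inS None *+ b) E false = gw (twist K b) E.
Proof.
move=> low; apply: le_anti; rewrite lift_weight_le_gw /=.
have [I IE ->] := lift_weight_attained (twist K b) (j + inS None *+ b) E.
by have [J JE] := low I IE; apply: le_trans; exact: gw_le.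
Qed.

Lemma tri_small j : -1 <= j <= 0 -> tri j = 0.
Proof.
move=> jb; have [->|->] : j = -1 \/ j = 0 by lia.
all: by apply: (@mulfI _ (2 : int)); rewrite // triE.
Qed.

(** lift_weight_le_gw bounds the two weights by these values, so both of them
    are maximal at the level j. *)
Definition is_peak K E j := lift_weight K j E false = gw K E /\
  knot_weight K j E false = gw (add2dual K None) E.

Lemma is_peakP K E j : (forall b (I : {set V}), I \subset E ->
    exists2 J : {set V}, J \subset E &
      fw (twist K b) J <= fw (twist K b) I - tri (j + (inS None *+ b + S_count I))) ->
  is_peak K E j.
Proof.
move=> low; split.
  rewrite -[j]addr0 -(mulr0n (inS None)); apply: (@lift_weight_twist K j E false).
  by move=> I /(low false); rewrite addrA.
apply: (@lift_weight_twist K j E true) => I /(low true); by rewrite addrA.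
Qed.

Section Cut.
Variables (v : V) (w : option V) (X : {set V}).
Hypotheses (S_vw : S = [set Some v; w]) (vw_cut : cuts v w X).
Implicit Types (Y Z : {set V}).

(** Whether w belongs to the corner Z; for w = v_0 this means that the weight is
    that of the translate by 2v_0^*. *)
Definition meets Z b : int := \sum_(z in Z) (Some z == w)%:Z + (None == w)%:Z *+ b.

Lemma inS_X u : u \in X -> inS (Some u) = (u == v)%:Z.
Proof.
case: vw_cut => _ wX _ uX; rewrite /inS S_vw !inE (inj_eq Some_inj).
by rewrite (negbTE (wX u uX)) orbF.
Qed.

Lemma inS_notX x : (forall u, u \in X -> Some u != x) -> inS x = (x == w)%:Z.
Proof.
case: vw_cut => vX _ _ xX; rewrite /inS S_vw !inE eq_sym.
by rewrite (negbTE (xX v vX)).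
Qed.

Lemma sum_eqv Y (c : int) : \sum_(u in Y) (u == v)%:Z * c = (v \in Y)%:Z * c.
Proof.
rewrite -mulr_suml; congr (_ * _); rewrite big_mkcond (bigD1 v) //= eqxx big1 ?addr0.
  by case: (v \in Y).
by move=> u /negbTE ->; case: ifP.
Qed.

Lemma dot_cut Y x : Y \subset X -> (forall u, u \in X -> Some u != x) ->
  \sum_(u in Y) dot x u = (v \in Y)%:Z * (x == w)%:Z.
Proof.
case: vw_cut => _ _ cut YX xX; rewrite -sum_eqv; apply: eq_bigr => u uY.
have uX := subsetP YX u uY.
rewrite /dot eq_sym (negbTE (xX u uX)) (cut _ _ uX xX).
by case: (u == v); case: (x == w).
Qed.

Lemma notX_Some Z z : [disjoint X & Z] -> z \in Z -> forall u, u \in X -> Some u != Some z.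
Proof.
move=> XZ zZ u uX; rewrite (inj_eq Some_inj); apply: contraTneq uX => ->.
by rewrite (disjointFl XZ zZ).
Qed.

Lemma fw_cut K b Y Z : Y \subset X -> [disjoint X & Z] ->
  fw (twist K b) (Y :|: Z) = fw K Y + fw (twist K b) Z + (v \in Y)%:Z * meets Z b.
Proof.
move=> YX XZ; rewrite fwU; last exact: disjointWl YX XZ.
have -> : \sum_(u in Y) \sum_(z in Z) dot (Some u) z
    = (v \in Y)%:Z * \sum_(z in Z) (Some z == w)%:Z.
  rewrite exchange_big mulr_sumr; apply: eq_bigr => z zZ.
  under eq_bigr => u _ do rewrite dotC.
  by rewrite dot_cut //; exact: notX_Some zZ.
rewrite /meets; case: b => /=; last by rewrite mulr0n; ring.
by rewrite !fw_add2dual (@dot_cut Y None) //; ring.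
Qed.

Lemma S_count_cut b Y Z : Y \subset X -> [disjoint X & Z] ->
  inS None *+ b + S_count (Y :|: Z) = (v \in Y)%:Z + meets Z b.
Proof.
move=> YX XZ; rewrite (inS_notX (x := None)) // /meets /S_count.
have dYZ := disjointWl YX XZ.
have -> : \sum_(u in Y :|: Z) inS (Some u)
    = \sum_(u in Y) inS (Some u) + \sum_(u in Z) inS (Some u).
  by rewrite -bigU //; apply: eq_bigl => u; rewrite !inE.
have -> : \sum_(u in Y) inS (Some u) = (v \in Y)%:Z.
  rewrite -[RHS]mulr1 -sum_eqv; apply: eq_bigr => u uY.
  by rewrite inS_X ?mulr1 ?(subsetP YX).
have -> : \sum_(z in Z) inS (Some z) = \sum_(z in Z) (Some z == w)%:Z.
  by apply: eq_bigr => z zZ; rewrite inS_notX //; exact: notX_Some zZ.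
ring.
Qed.

Lemma meets_bounds Z b : [disjoint X & Z] -> 0 <= meets Z b <= 1.
Proof.
move=> XZ; have vX : [set v] \subset X by rewrite sub1set; case: vw_cut.
have := S_count_cut b vX XZ; rewrite inE eqxx => cE.
have := S_count_le ([set v] :|: Z).
have := S_count_ge0 Z; have := S_count_cut b (sub0set X) XZ.
rewrite set0U inE; have := inS_ge0 None; case: b cE => /=; rewrite ?mulr0n ?mulr1n; lia.
Qed.

(** A corner of the cube is a union of a part Y in X and a part Z outside, and
    by fw_cut both weights are fw K Y, plus a term in Z, plus 1 if v is in Y
    and Z meets w.  So comparing the least value of fw K Y over the Y that
    contain v with the least value over those that do not involves neither Z
    nor the choice of the weight.
    If v can be left out for free, take the level -1: only the corners with
    both v and w leave the zeros of tri, and dropping v regains the 1 of the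
    interaction.  Otherwise adding v gains at least 1, and at the level -2
    only the corners with neither v nor w leave the zeros of tri. *)
Lemma peak_cut K E : exists2 j, j = -1 \/ j = -2 & is_peak K E j.
Proof.
have splitE I : I \subset E ->
  [/\ I = (I :&: X) :|: (I :\: X), I :&: X \subset X, [disjoint X & I :\: X],
      I :&: X \subset E :&: X & I :\: X \subset E].
  move=> IE; split; first by rewrite setID.
  - exact: subsetIr.
  - by rewrite disjoint_sym disjoints_subset subsetDr.
  - exact: setSI.
  by apply: subset_trans IE; exact: subsetDl.
have joinE (Y Z : {set V}) : Y \subset E :&: X -> Z \subset E -> Y :|: Z \subset E.
  by move=> YE ZE; rewrite subUset ZE (subset_trans YE) ?subsetIl.
have [/existsP [Y1 /and3P [Y1E vY1 /forallP Y1min]]|/existsPn noY1] :=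
  boolP [exists Y1 : {set V}, [&& Y1 \subset E :&: X, v \in Y1 &
    [forall Y : {set V}, (Y \subset E :&: X) && (v \notin Y) ==> (fw K Y1 < fw K Y)]]].
  exists (-2); first by right.
  apply: is_peakP => b I IE; have [IE' IX XI IXE IDE] := splitE I IE.
  have mb := meets_bounds b XI; have cE := S_count_cut b IX XI; rewrite -IE' in cE.
  have fI := fw_cut K b IX XI; rewrite -IE' in fI; rewrite cE.
  have [vI|vI] := boolP (v \in I :&: X).
    by exists I => //; rewrite tri_small ?subr0 //; clear -mb; lia.
  have [m0|m1] : meets (I :\: X) b = 0 \/ meets (I :\: X) b = 1 by clear -mb; lia.
    exists (Y1 :|: (I :\: X)); first exact: joinE.
    have Y1X : Y1 \subset X by rewrite (subset_trans Y1E) ?subsetIr.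
    rewrite fI fw_cut // m0 (_ : tri (-2 + _) = 1) // !mulr0 !addr0.
    by have := Y1min (I :&: X); rewrite IXE vI /= => lt1; clear -lt1; lia.
  by exists I => //; rewrite m1 tri_small ?subr0.
exists (-1); first by left.
apply: is_peakP => b I IE; have [IE' IX XI IXE IDE] := splitE I IE.
have mb := meets_bounds b XI; have cE := S_count_cut b IX XI; rewrite -IE' in cE.
have fI := fw_cut K b IX XI; rewrite -IE' in fI; rewrite cE.
have [vI|vI] := boolP (v \in I :&: X); last first.
  by exists I => //; rewrite tri_small ?subr0 //; clear -mb; lia.
have [m0|m1] : meets (I :\: X) b = 0 \/ meets (I :\: X) b = 1 by clear -mb; lia.
  by exists I => //; rewrite m0 tri_small ?subr0.
have := noY1 (I :&: X); rewrite IXE vI /= => /forallPn [Y].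
rewrite negb_imply -leNgt => /andP [/andP [YE vY] le_f].
exists (Y :|: (I :\: X)); first exact: joinE.
have YX : Y \subset X by rewrite (subset_trans YE) ?subsetIr.
rewrite fI fw_cut // m1 (_ : tri (-1 + _) = 1) // vI (negbTE vY) mul0r addr0 mulr1.
by clear -le_f; lia.
Qed.

End Cut.

Lemma peak_exists K E : exists2 j, j = -1 \/ j = -2 & is_peak K E j.
Proof.
have [S_small|S_big] := leqP #|S| 1.
  exists (-1); first by left.
  apply: is_peakP => b I IE; exists I => //.
  have cb : S_count I + inS None <= 1 by apply: le_trans (S_count_le_card I) _.
  have := inS_ge0 None; have := S_count_ge0 I => c0 n0.
  rewrite tri_small ?subr0 //; case: b => /=; rewrite ?mulr0n ?mulr1n; lia.
have /cards2P [x [y [xy Exy]]] : #|S| == 2 by rewrite eqn_leq S_card.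
have /forest_cut [v [w [X [Evw cut]]]] : edge x y.
  by apply: S_clique; rewrite ?Exy ?set21 ?set22.
by apply: (peak_cut _ cut); rewrite Exy.
Qed.

(** * The contraction of the exceptional direction *)

Definition peak K E : int := if `[< is_peak K E (-1) >] then -1 else -2.

Lemma peakP K E : is_peak K E (peak K E).
Proof.
rewrite /peak; case: asboolP => // no1.
by have [j [->|->]] := peak_exists K E.
Qed.

Lemma knot_weight_split K j E :
  knot_weight K j E true = Num.min (knot_weight K j E false) (knot_weight K (j - 1) E false).
Proof. by rewrite /knot_weight lift_weight_split addrAC. Qed.

(** The weights rise up to level -2 and fall from level -1 on; only the step
    between these two depends on the position of the peak. *)
Lemma unimodal (p : int -> int) (c : int) :
  (forall j, j <= -3 -> p j <= p (j + 1)) -> (forall j, -1 <= j -> p (j + 1) <= p j) ->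
  (forall j, p j <= p c) -> c = -1 \/ c = -2 ->
  forall i j, Num.min j c <= i <= Num.max j c -> p j <= p i.
Proof.
move=> up down top cE i j ij; have [->//|ic] := eqVneq i c.
have [jc|cj] := leP j c; rewrite ?(min_l jc) ?(max_r jc) in ij.
  have [n iE] : exists n : nat, i = j + n%:Z by exists `|i - j|%N; lia.
  have iup : i <= -2 by lia.
  rewrite {}iE in iup *; elim: n iup => [|n IH] iup; first by rewrite addr0.
  apply: le_trans (IH _) _; first by lia.
  have -> : j + n.+1%:Z = j + n%:Z + 1 by lia.
  by apply: up; lia.
rewrite (min_r (ltW cj)) (max_l (ltW cj)) in ij.
have [n jE] : exists n : nat, j = i + n%:Z by exists `|j - i|%N; lia.
have iup : -1 <= i by lia.
rewrite jE; elim: n {jE cj ij} => [|n IH]; first by rewrite addr0.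
apply: le_trans IH; have -> : i + n.+1%:Z = i + n%:Z + 1 by lia.
by apply: down; lia.
Qed.

Lemma peak_level K E : peak K E = -1 \/ peak K E = -2.
Proof. by rewrite /peak; case: asboolP; [left|right]. Qed.

Lemma weight_towards_peak K E i j :
  Num.min j (peak K E) <= i <= Num.max j (peak K E) ->
  lift_weight K j E false <= lift_weight K i E false /\
  knot_weight K j E false <= knot_weight K i E false.
Proof.
have [top ktop] := peakP K E; move=> ij; split.
  apply: (@unimodal (fun t => lift_weight K t E false) _ _ _ _ (peak_level K E)) ij => t.
  - by move=> t3; apply: lift_weight_up; have := inS_ge0 None; lia.
  - exact: lift_weight_down.
  - by rewrite top lift_weight_le_gw.
apply: (@unimodal (fun t => knot_weight K t E false) _ _ _ _ (peak_level K E)) ij => t.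
- by move=> t3; rewrite /knot_weight addrAC; apply: lift_weight_up; lia.
- move=> t1; rewrite /knot_weight addrAC; apply: lift_weight_down.
  by have := inS_ge0 None; lia.
by rewrite ktop lift_weight_le_gw.
Qed.

Definition cube K j E b : gen Delta := (lift K j, lift_set E b).

Lemma cubeP (k : gen Delta) : exists K j E b, k = cube K j E b.
Proof.
case: k => L E; exists (proj L), (height L), (proj_set E), (ex \in E).
by rewrite /cube projK proj_setK.
Qed.

Definition on_cubes (M : Type) (F : char Gamma -> int -> {set V} -> bool -> M)
    (k : gen Delta) : M :=
  F (proj k.1) (height k.1) (proj_set k.2) (ex \in k.2).

Lemma on_cubesE (M : Type) (F : char Gamma -> int -> {set V} -> bool -> M) K j E b :
  on_cubes F (cube K j E b) = F K j E b.
Proof. by rewrite /on_cubes /cube /= liftK height_lift lift_setK lift_set_ex. Qed.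

Lemma linear_cube_eq (M : lmodType F2U) (F G : {linear CF Delta -> M}) :
  (forall K j E b, F << cube K j E b >> = G << cube K j E b >>) -> F =1 G.
Proof.
by move=> FG; apply: linear_gen_eq => k; have [K [j [E [b ->]]]] := cubeP k.
Qed.

(** The part of the boundary that keeps the exceptional direction. *)
Definition horizontal K j E b : CF Delta :=
  \sum_(u in E) \sum_(e : bool)
    << 'X^(absz (corner_weight K u e
                 + lift_weight (corner K u e) (j + inS (Some u) *+ e) (E :\ u) b
                 - lift_weight K j E b)%R)
       *g cube (corner K u e) (j + inS (Some u) *+ e) (E :\ u) b >>.

Definition vertical K j E : CF Delta :=
  \sum_(e : bool)
    << 'X^(absz (lift_weight K (j - e%:Z) E false - lift_weight K j E true)%R)
       *g cube K (j - e%:Z) E false >>.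

Lemma horizontal_gain_ge0 K j E b u e : u \in E ->
  0 <= corner_weight K u e
       + lift_weight (corner K u e) (j + inS (Some u) *+ e) (E :\ u) b
       - lift_weight K j E b.
Proof.
by move=> uE; rewrite -facet_gain_old; apply: facet_gain_ge0; rewrite lift_set_old.
Qed.

Lemma vertical_gain_ge0 K j E (e : bool) :
  lift_weight K j E true <= lift_weight K (j - e%:Z) E false.
Proof.
by rewrite lift_weight_split; case: e; rewrite ge_min ?subr0 lexx ?orbT.
Qed.

Lemma boundary_cube K j E b :
  boundary << cube K j E b >> = horizontal K j E b + (if b then vertical K j E else 0).
Proof.
rewrite boundaryU boundary_genE sum_lift_set addrC; congr (_ + _).
  apply: eq_bigr => u _; apply: eq_bigr => e _.
  by rewrite facet_gain_old corner_old lift_setD_old.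
case: b => //; apply: eq_bigr => e _.
by rewrite facet_gain_ex corner_ex lift_setD_ex.
Qed.

Definition collapse_cube K j E b : CF Gamma :=
  if b then 0 else
  << 'X^(absz (gw K E - lift_weight K j E false)%R) *g ((K, E) : gen Gamma) >>.

Definition collapse : {linear CF Delta -> CF Gamma} := span_map (on_cubes collapse_cube).

Definition peak_cube (k : gen Gamma) : CF Delta := << cube k.1 (peak k.1 k.2) k.2 false >>.

Definition include : {linear CF Gamma -> CF Delta} := span_map peak_cube.

(** A cube at level j goes to the edges that lead from its level to the peak;
    the edge at level t joins the levels t and t - 1. *)
Definition contract_cube K j E b : CF Delta :=
  if b then 0 else
  let lo := Num.min j (peak K E) in
  \sum_(i < absz (j - peak K E))
    << 'X^(absz (lift_weight K (lo + i%:Z + 1) E true - lift_weight K j E false)%R)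
       *g cube K (lo + i%:Z + 1) E true >>.

Definition contract : {linear CF Delta -> CF Delta} := span_map (on_cubes contract_cube).

Lemma collapseE K j E b : collapse << cube K j E b >> = collapse_cube K j E b.
Proof. by rewrite /collapse /= span_mapU on_cubesE scale1r. Qed.

Lemma contractE K j E b : contract << cube K j E b >> = contract_cube K j E b.
Proof. by rewrite /contract /= span_mapU on_cubesE scale1r. Qed.

Lemma includeE K E : include << ((K, E) : gen Gamma) >> = << cube K (peak K E) E false >>.
Proof. by rewrite /include /= span_mapU scale1r. Qed.

Lemma collapseZ a K j E b : collapse << a *g cube K j E b >> = a *: collapse_cube K j E b.
Proof. by rewrite -[a in LHS]mulr1 -scale_genE linearZ /= collapseE. Qed.

Lemma contractZ a K j E b : contract << a *g cube K j E b >> = a *: contract_cube K j E b.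
Proof. by rewrite -[a in LHS]mulr1 -scale_genE linearZ /= contractE. Qed.

(** The two ends of an edge collapse to the same cube, with the same power of U. *)
Lemma collapse_vertical K j E : collapse (vertical K j E) = 0.
Proof.
have wE e := vertical_gain_ge0 K j E e; have gE i := lift_weight_le_gw K i E.
rewrite linear_sum /= big_bool /= !collapseZ /collapse_cube !scale_genE -!exprD.
set a := (X in 'X^X); set c := (X in _ + << 'X^X *g _ >>).
have <- : a = c.
  rewrite /a /c; have := wE true; have := wE false.
  have := gE (j - true%:Z); have := gE (j - false%:Z).
  move: (lift_weight K (j - true%:Z) E false) (lift_weight K (j - false%:Z) E false).
  by move: (lift_weight K j E true) => w0 w1 w2; lia.
exact: addrr_F2.
Qed.

Lemma collapse_chain z : collapse (boundary z) = boundary (collapse z).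
Proof.
pose B (G : forest) : {linear CF G -> CF G} := @boundary G.
apply: (@linear_cube_eq _ (collapse \o B Delta) (B Gamma \o collapse)) => K j E b /=.
rewrite boundary_cube linearD /= collapseE /collapse_cube.
case: b.
  rewrite collapse_vertical addr0 (linear0 (B Gamma)) linear_sum big1 // => u _.
  by rewrite linear_sum big1 //= => e _; rewrite collapseZ scaler0.
rewrite linear0 addr0 boundaryZ boundary_genE linear_sum scaler_sumr.
apply: eq_bigr => u uE; rewrite linear_sum scaler_sumr; apply: eq_bigr => e _ /=.
rewrite collapseZ /collapse_cube !scale_genE -!exprD.
have := horizontal_gain_ge0 K j false e uE; have := facet_gain_ge0 K e uE.
have := lift_weight_le_gw (corner K u e) (j + inS (Some u) *+ e) (E :\ u).
have := lift_weight_le_gw K j E; rewrite /facet_gain => g1 g2 g3 g4.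
by congr (<< 'X^_ *g _ >>); lia.
Qed.

Lemma collapse_include z : collapse (include z) = z.
Proof.
apply: (@linear_gen_eq _ _ (collapse \o include) idfun) => -[K E] /=.
rewrite includeE collapseE /collapse_cube.
by have [-> _] := peakP K E; rewrite subrr.
Qed.

Lemma collapse_contract z : collapse (contract z) = 0.
Proof.
apply: (@linear_cube_eq _ (collapse \o contract) \0) => K j E b /=.
rewrite contractE /contract_cube; case: b; first by rewrite linear0.
by rewrite linear_sum big1 // => i _; rewrite /= collapseZ scaler0.
Qed.

Lemma contract_edge_weight K j E (i : 'I_(absz (j - peak K E))) :
  let t := Num.min j (peak K E) + i%:Z + 1 in
  lift_weight K j E false <= lift_weight K t E true /\
  knot_weight K j E false <= knot_weight K t E true.
Proof.
move=> t; have [a1 k1] : lift_weight K j E false <= lift_weight K t E false /\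
    knot_weight K j E false <= knot_weight K t E false.
  by apply: weight_towards_peak; rewrite /t; have := ltn_ord i; lia.
have [a2 k2] : lift_weight K j E false <= lift_weight K (t - 1) E false /\
    knot_weight K j E false <= knot_weight K (t - 1) E false.
  by apply: weight_towards_peak; rewrite /t; have := ltn_ord i; lia.
by rewrite lift_weight_split knot_weight_split !le_min a1 a2 k1 k2.
Qed.

Definition level_cube K j E t : CF Delta :=
  << 'X^(absz (lift_weight K t E false - lift_weight K j E false)%R) *g cube K t E false >>.

Lemma sum_consecutive (M : lmodType F2U) (f : int -> M) (a : int) (n : nat) :
  \sum_(i < n) (f (a + i%:Z + 1) + f (a + i%:Z)) = f (a + n%:Z) + f a.
Proof.
elim: n => [|n IH]; first by rewrite big_ord0 addr0 addrr_F2.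
rewrite big_ord_recr /= IH (_ : a + n.+1%:Z = a + n%:Z + 1); last by lia.
by rewrite [f (a + n%:Z) + _]addrC addrACA [f (a + n%:Z) + _]addrr_F2 addr0 addrC.
Qed.

Lemma scale_vertical K j E t :
  lift_weight K j E false <= lift_weight K t E true ->
  'X^(absz (lift_weight K t E true - lift_weight K j E false)%R) *: vertical K t E
  = level_cube K j E t + level_cube K j E (t - 1).
Proof.
move=> jt; have w0 := vertical_gain_ge0 K t E false; rewrite subr0 in w0.
have w1 : lift_weight K t E true <= lift_weight K (t - 1) E false
  := vertical_gain_ge0 K t E true.
rewrite /vertical big_bool scalerDr !scale_genE -!exprD addrC /level_cube subr0.
move: jt w0 w1; move: (lift_weight K t E true) (lift_weight K j E false).
move: (lift_weight K t E false) (lift_weight K (t - 1) E false).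
by move=> a b c d dc ca cb; congr (_ + _); congr (<< 'X^_ *g _ >>); lia.
Qed.

(** The vertical boundaries of the edges from level j to the peak telescope. *)
Lemma vertical_contract K j E :
  \sum_(i < absz (j - peak K E)%R)
     'X^(absz (lift_weight K (Num.min j (peak K E) + i%:Z + 1) E true
               - lift_weight K j E false)%R)
       *: vertical K (Num.min j (peak K E) + i%:Z + 1) E
  = << cube K j E false >> + include (collapse_cube K j E false).
Proof.
set p := peak K E.
transitivity (\sum_(i < absz (j - p)%R) (level_cube K j E (Num.min j p + i%:Z + 1)
    + level_cube K j E (Num.min j p + i%:Z))).
  apply: eq_bigr => i _; rewrite scale_vertical ?addrK //.
  by have [] := contract_edge_weight i.
rewrite sum_consecutive.
have -> : << cube K j E false >> = level_cube K j E j by rewrite /level_cube subrr.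
have -> : include (collapse_cube K j E false) = level_cube K j E p.
  rewrite /collapse_cube -[X in << X *g _ >>]mulr1 -scale_genE linearZ /= includeE.
  by rewrite scale_genE mulr1 /level_cube; have [-> _] := peakP K E.
have [jp|pj] := leP j p.
  by rewrite [LHS]addrC; congr (_ + level_cube K j E _); clear -jp; lia.
by congr (level_cube K j E _ + _); clear -pj; lia.
Qed.

(** Contracting from levels j and j - 1 differs in the edge between them. *)
Lemma contract_vertical K j E : contract (vertical K j E) = << cube K j E true >>.
Proof.
pose edge_cube t : CF Delta :=
  << 'X^(absz (lift_weight K t E true - lift_weight K j E true)%R) *g cube K t E true >>.
set p := peak K E.
have contract_edges (e : bool) :
    contract << 'X^(absz (lift_weight K (j - e%:Z) E false - lift_weight K j E true)%R)
       *g cube K (j - e%:Z) E false >>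
    = \sum_(i < absz (j - e%:Z - p)%R) edge_cube (Num.min (j - e%:Z) p + i%:Z + 1).
  rewrite contractZ /contract_cube scaler_sumr; apply: eq_bigr => i _.
  rewrite scale_genE -exprD; congr (<< 'X^_ *g _ >>).
  have /= [wi _] := contract_edge_weight i; have := vertical_gain_ge0 K j E e.
  move: wi; move: (lift_weight K (_ + 1) E true) (lift_weight K j E true).
  by move: (lift_weight K (j - e%:Z) E false) => a c d; clear; lia.
have -> : << cube K j E true >> = edge_cube j by rewrite /edge_cube subrr.
rewrite linear_sum big_bool (contract_edges true) (contract_edges false) subr0.
rewrite -[true%:Z]/(1 : int).
have [jp|pj] := leP j p.
  rewrite (_ : absz (j - 1 - p)%R = (absz (j - p)%R).+1); last by clear -jp; lia.
  rewrite big_ord_recl /= (_ : Num.min (j - 1) p = j - 1); last by clear -jp; lia.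
  rewrite addr0 subrK -addrA.
  have -> : \sum_(i < absz (j - p)%R) edge_cube (j - 1 + (bump 0 i)%:Z + 1)
      = \sum_(i < absz (j - p)%R) edge_cube (j + i%:Z + 1).
    by apply: eq_bigr => i _; congr edge_cube; rewrite /bump; clear; lia.
  by rewrite addrr_F2 addr0.
rewrite (_ : absz (j - p)%R = (absz (j - 1 - p)%R).+1); last by clear -pj; lia.
rewrite big_ord_recr /= (_ : Num.min (j - 1) p = p); last by clear -pj; lia.
rewrite addrA addrr_F2 add0r; congr edge_cube; clear -pj; lia.
Qed.

Definition rank_lt (n : nat) (k : gen Delta) (i : nat) : Prop := (#|proj_set k.2| < n)%N.

Lemma rank_cube n K j E b i : rank_lt n (cube K j E b) i <-> (#|E| < n)%N.
Proof. by rewrite /rank_lt lift_setK. Qed.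

Lemma horizontal_rank K j E b : supported (rank_lt #|E|) (horizontal K j E b).
Proof.
apply: supported_sum => u uE; apply: supported_sum => e _.
apply: supportedU; apply/rank_cube.
by rewrite (cardsD1 u E) uE.
Qed.

Lemma contract_rank n z : supported (rank_lt n) z -> supported (rank_lt n) (contract z).
Proof.
apply: supported_span => k i; have [K [j [E [b ->]]]] := cubeP k => /rank_cube En.
rewrite contractE /contract_cube; case: b; first exact: supported0.
by apply: supported_sum => t _; apply: supportedU; apply/rank_cube.
Qed.

(** The contraction is exact for the vertical part of the boundary, and the
    horizontal part removes a direction.  Modulo 2 the expression is, on the
    kernel of collapse, the deformation attached to contract. *)
Lemma deform_rank z n : supported (rank_lt n.+1) z ->
  supported (rank_lt n)
    (z + include (collapse z) + (boundary (contract z) + contract (boundary z))).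
Proof.
pose B : {linear CF Delta -> CF Delta} := @boundary Delta.
pose D : {linear CF Delta -> CF Delta} :=
  (idfun \+ (include \o collapse)) \+ ((B \o contract) \+ (contract \o B)).
rewrite -[_ + _ + _]/(D z); apply: supported_span => k i.
have [K [j [E [b ->]]]] := cubeP k => /rank_cube; rewrite ltnS => En.
have le_rank t : supported (rank_lt #|E|) t -> supported (rank_lt n) t.
  by move=> tE k' i' /tE; rewrite /rank_lt => kE; apply: leq_trans En.
apply: le_rank => /=.
rewrite collapseE contractE boundary_cube linearD /=.
case: b => /=.
  rewrite linear0 (linear0 B) addr0 add0r contract_vertical addrCA addrr_F2 addr0.
  exact/contract_rank/horizontal_rank.
rewrite linear0 addr0 addrA; apply: supportedD; last exact/contract_rank/horizontal_rank.
rewrite [boundary _](linear_sum B) /=.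
under eq_bigr => t _ do
  rewrite /B boundaryZ -boundaryU boundary_cube scalerDr.
rewrite big_split /= vertical_contract addrCA addrr_F2 addr0.
by apply: supported_sum => t _; apply: supportedZ; apply: horizontal_rank.
Qed.

Section Equivalence.
Hypotheses (nd : negative_definite Gamma) (nd' : negative_definite Delta).
Variables m m' : int.
Local Notation CG := (lattice_complex Gamma m).
Local Notation CD := (lattice_complex Delta m').

Lemma collapse_filtered : filtered (collapse : CD -> CG).
Proof.
apply: filtered_gen => L F; have [K [j [E [b [-> ->]]]]] := cubeP (L, F).
rewrite collapseE /collapse_cube; case: b; first exact: supported0.
apply: supportedU => /=; rewrite (alexander_gw nd) (alexander_lift nd nd') lerD2r ler_int.
have := lift_weight_le_gw K j E.
by have := lift_weight_le_gw (add2dual K None) (j + inS None) E; rewrite /knot_weight; lia.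
Qed.

Lemma include_filtered : filtered (include : CG -> CD).
Proof.
apply: filtered_gen => K E; rewrite includeE -(expr0 'X).
apply: supportedU => /=; rewrite (alexander_gw nd) (alexander_lift nd nd').
by have [-> ->] := peakP K E.
Qed.

Lemma contract_filtered : filtered (contract : CD -> CD).
Proof.
apply: filtered_gen => L F; have [K [j [E [b [-> ->]]]]] := cubeP (L, F).
rewrite contractE /contract_cube; case: b; first exact: supported0.
apply: supported_sum => i _; apply: supportedU.
rewrite /= !(alexander_lift nd nd') lerD2r ler_int.
by have /= [] := contract_edge_weight i; lia.
Qed.

Lemma blowup_equivalence : filtered_homotopy_equivalent CD CG.
Proof.
apply: (@deformation_equivalence CD CG collapse include contract #|V|.+1).
- exact: lattice_ultrametric.
- exact: knot_level0.
- exact: boundary_boundary.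
- exact: boundary_filtered.
- exact: collapse_filtered.
- exact: include_filtered.
- exact: contract_filtered.
- exact: collapse_chain.
- exact: collapse_include.
- exact: collapse_contract.
have vanish n (z : CF Delta) : supported (rank_lt n) z -> collapse z = 0 ->
    iter n (deform (C := CD) contract) z = 0.
  elim: n z => [|n IH] z zn z0.
    apply/eqP/freeg_eqP => k; rewrite coeff0; apply/polyP => i; rewrite coef0.
    by apply/eqP; apply/negPn/negP => /zn.
  rewrite iterSr; apply: IH; last first.
    rewrite -[RHS]z0; apply: (@phi_deform CD CG) => //; first exact: collapse_chain.
    exact: collapse_contract.
  have := deform_rank zn; rewrite z0 linear0 addr0 /deform [- (_ + _)]oppr_F2.
  by [].
by move=> z; apply: vanish => k i _; rewrite /rank_lt ltnS max_card.
Qed.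

End Equivalence.
End Peak.
End Blowup.

Theorem proposition0p3 (Gamma1 Gamma2 : forest) (m1 m2 : int) :
  negative_definite Gamma1 -> negative_definite Gamma2 ->
  differ_by_blowup Gamma1 Gamma2 ->
  filtered_homotopy_equivalent (lattice_complex Gamma1 m1) (lattice_complex Gamma2 m2).
Proof.
have main (Gamma Delta : forest) (S : {set option (vert Gamma)}) (m m' : int) :
    negative_definite Gamma -> negative_definite Delta -> (#|S| <= 2)%N ->
    (forall x y, x \in S -> y \in S -> x != y -> edge x y) -> blowup_at Delta S ->
    filtered_homotopy_equivalent (lattice_complex Delta m') (lattice_complex Gamma m).
  move=> nd nd' S2 S_clique [h [hi hK hiK] /= [h1 h2 h3 h4]].
  exact: (@blowup_equivalence Gamma Delta S h hi hK hiK h1 h2 h3 h4 S_clique S2 nd nd').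
have blow (Gamma Delta : forest) m m' : negative_definite Gamma ->
    negative_definite Delta -> is_blowup Gamma Delta ->
    filtered_homotopy_equivalent (lattice_complex Delta m') (lattice_complex Gamma m).
  move=> nd nd' [|[v]|[v [w [vw]]]]; apply: main => //.
  - by rewrite cards0.
  - by move=> x y; rewrite inE.
  - by rewrite cards1.
  - by move=> x y /set1P -> /set1P ->; rewrite eqxx.
  - by rewrite cards2; case: (v != w).
  move=> x y; rewrite !inE => /orP [] /eqP -> /orP [] /eqP ->; rewrite ?eqxx //.
  by rewrite edge_sym.
by move=> nd1 nd2 [] /blow; [move/(_ m1 m2 nd1 nd2)/filtered_homotopy_equivalent_sym | exact].
Qed.
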